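(* Let $S=(Z_1,\dots,Z_n)$ consist of $n$ i.i.d. samples from a distribution $\mu$ on $\mathsf Z$, and let $P_{W|S}$ be any conditional distribution (learning algorithm) with values $W=(W_1,\dots,W_d)\in\mathcal B_1\times\cdots\times\mathcal B_d$. Then $$\mathrm{gen}(\mu,P_{W|S})\le\frac{LMR\sqrt2}{\sqrt n}\sum_{k=1}^d\beta_k\sqrt{I(S;W_1,\dots,W_k)},$$ where $I(S;W_1,\dots,W_k)$ is the mutual information under the joint distribution $\mu^{\otimes n}P_{W|S}$.
   Context: Let $d\ge2$, let $m,\delta_1,\dots,\delta_d$ be positive integers, $\delta_0=m$, $R>0$, $\mathcal X=\{x\in\mathbb R^m:|x|_2\le R\}$ ($|\cdot|_2$ Euclidean norm), $\mathcal Y$ a set and $\mathsf Z=\mathcal X\times\mathcal Y$. For $1\le j\le d$ fix $M_j\in\mathbb R^{\delta_j\times\delta_{j-1}}$ with $\|M_j\|_2>0$ (spectral norm) and $\alpha_j>0$, and let $\mathcal B_j=\{\mathbf W\in\mathbb R^{\delta_j\times\delta_{j-1}}:\|\mathbf W-M_j\|_2\le\alpha_j\|M_j\|_2\}$. Let $\phi$ be an activation (acting on vectors of every relevant dimension, e.g. entrywise ReLU) that is $1$-Lipschitz w.r.t. the Euclidean norm with $\phi(0)=0$, and $\phi_o$ either the identity or the soft-max on $\mathbb R^{\delta_d}$. For $w=(\mathbf W_1,\dots,\mathbf W_d)\in\mathcal B_1\times\cdots\times\mathcal B_d$ let $h_w(x)=\phi_o(\mathbf W_d\,\phi(\mathbf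 W_{d-1}\cdots\phi(\mathbf W_1x)\cdots))$. Let $M=\prod_{j=1}^d\|M_j\|_2$ and $\beta_k=\alpha_k\exp(\sum_{i=1}^{k-1}\alpha_i)$. Let $\ell:(\mathcal B_1\times\cdots\times\mathcal B_d)\times\mathsf Z\to[0,\infty)$ be a measurable loss for which there is $L>0$ with $|\ell(w,z)-\ell(w',z)|\le L|h_w(x)-h_{w'}(x)|_2$ for all $w,w'$ and all $z=(x,y)\in\mathsf Z$. Define $L_\mu(w)=\mathbb E[\ell(w,Z)]$ with $Z\sim\mu$, $L_S(w)=\frac1n\sum_{i=1}^n\ell(w,Z_i)$, and the expected generalization error $\mathrm{gen}(\mu,P_{W|S})=\mathbb E[L_\mu(W)-L_S(W)]$, the expectation being under the joint law $\mu^{\otimes n}P_{W|S}$ of $(S,W)$. *)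

(* Defs.v *)
From HB Require Import structures.
From mathcomp Require Import all_boot all_order all_algebra.
From mathcomp Require Import all_classical all_reals all_analysis.
Import Order.TTheory GRing.Theory Num.Theory.


Local Open Scope classical_set_scope.
Local Open Scope ring_scope.

Definition vec (R : realType) (m : nat) := 'cV[R]_m.
HB.instance Definition _ (R : realType) m := Choice.on (vec R m).
HB.instance Definition _ (R : realType) m := isPointed.Build (vec R m) 0.

(* weights w = (W_1,...,W_d); layer j : 'I_d stands for W_{j+1},
   a delta_{j+1} x delta_j matrix (delta 0 = m is the input dimension) *)
Definition Wt (R : realType) (d : nat) (δ : nat -> nat) :=
  forall j : 'I_d, 'M[R]_(δ j.+1, δ j).
HB.instance Definition _ (R : realType) d δ := gen_eqMixin (Wt R d δ).
HB.instance Definition _ (R : realType) d δ := gen_choiceMixin (Wt R d δ).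
HB.instance Definition _ (R : realType) d δ :=
  isPointed.Build (Wt R d δ) (fun j => 0).

Definition vnorm (R : realType) (k : nat) (v : 'cV[R]_k) : R :=
  Num.sqrt (\sum_(i < k) v i ord0 ^+ 2).

Definition specnorm (R : realType) (p q : nat) (A : 'M[R]_(p, q)) : R :=
  sup [set vnorm R p (A *m x) | x in [set x : 'cV[R]_q | vnorm R q x <= 1]].

Definition softmax (R : realType) (k : nat) (v : 'cV[R]_k) : 'cV[R]_k :=
  \col_i (expR (v i ord0) / \sum_(j < k) expR (v j ord0)).

Definition out_act (R : realType) (so : bool) (k : nat) (v : 'cV[R]_k) :=
  if so then softmax R k v else v.

(* the matrix of layer k+1 (0 outside the range, never used there) *)
Definition layer (R : realType) (d : nat) (δ : nat -> nat) (w : Wt R d δ)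
  (k : nat) : 'M[R]_(δ k.+1, δ k) :=
  match (k < d)%N as b return (k < d)%N = b -> 'M[R]_(δ k.+1, δ k) with
  | true => fun H => w (Ordinal H)
  | false => fun _ => 0
  end erefl.

Fixpoint hidden (R : realType) (d : nat) (δ : nat -> nat)
  (φ : forall k, 'cV[R]_k -> 'cV[R]_k) (w : Wt R d δ) (x : 'cV[R]_(δ 0))
  (k : nat) : 'cV[R]_(δ k) :=
  match k with
  | 0 => x
  | k'.+1 => φ _ (layer R d δ w k' *m hidden R d δ φ w x k')
  end.

Definition net (R : realType) (d : nat) (δ : nat -> nat)
  (φ : forall k, 'cV[R]_k -> 'cV[R]_k) (so : bool) (w : Wt R d δ)
  (x : 'cV[R]_(δ 0)) : 'cV[R]_(δ d.-1.+1) :=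
  out_act R so _ (layer R d δ w d.-1 *m hidden R d δ φ w x d.-1).

Definition Bset (R : realType) (d : nat) (δ : nat -> nat) (M : Wt R d δ)
  (α : 'I_d -> R) : set (Wt R d δ) :=
  [set w | forall j : 'I_d, specnorm R _ _ (w j - M j) <= α j * specnorm R _ _ (M j)].

(* Borel sets of R^m = sigma-algebra generated by the coordinates *)
Definition GX (R : realType) (m : nat) : set (set (vec R m)) :=
  [set A | exists (i : 'I_m) (B : set R),
     measurable B /\ A = [set x : vec R m | B (x i ord0)]].
Definition XT (R : realType) (m : nat) := g_sigma_algebraType (GX R m).

Definition ZT (R : realType) (m : nat) (dY : measure_display)
  (Y : measurableType dY) := (XT R m * Y)%type.

(* Borel sets of the weight space (product of matrix spaces) *)
Definition GW (R : realType) (d : nat) (δ : nat -> nat) : set (set (Wt R d δ)) :=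
  [set A | exists (j : 'I_d) (a : 'I_(δ j.+1)) (b : 'I_(δ j)) (B : set R),
     measurable B /\ A = [set w : Wt R d δ | B (w j a b)]].
Definition WT (R : realType) (d : nat) (δ : nat -> nat) :=
  g_sigma_algebraType (GW R d δ).

Definition Zset (R : realType) (m : nat) (dY : measure_display)
  (Y : measurableType dY) (Rx : R) : set (ZT R m dY Y) :=
  [set z | vnorm R m (z.1 : 'cV[R]_m) <= Rx].

Definition sigmaS (dΩ : measure_display) (Ω : measurableType dΩ)
  (R : realType) (m : nat) (dY : measure_display) (Y : measurableType dY)
  (n : nat) (Z : 'I_n -> Ω -> ZT R m dY Y) : set (set Ω) :=
  <<s [set E | exists (i : 'I_n) (A : set (ZT R m dY Y)),
         measurable A /\ E = Z i @^-1` A] >>.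

(* sigma(W_1, ..., W_{k+1}) (0-indexed layers j <= k) *)
Definition sigmaW (dΩ : measure_display) (Ω : measurableType dΩ)
  (R : realType) (d : nat) (δ : nat -> nat) (W : Ω -> WT R d δ) (k : nat)
  : set (set Ω) :=
  <<s [set E | exists (j : 'I_d) (a : 'I_(δ j.+1)) (b : 'I_(δ j)) (B : set R),
         (j <= k)%N /\ measurable B /\ E = [set ω | B (W ω j a b)]] >>.

(* Mutual information (Pinsker / Dobrushin definition): supremum over  *)
(* finite partitions (E_i) of sigma(S) and (F_j) of sigma(W) of        *)
(*   sum_{i,j} P(E_i n F_j) ln (P(E_i n F_j) / (P(E_i) P(F_j)))        *)
(* with 0 ln(0/.) = 0.                                                 *)

Definition mi_term (R : realType) (p q r : R) : R :=
  if p == 0 then 0 else p * ln (p / (q * r)).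

Definition is_partition (T : Type) (F : set (set T)) (a : nat)
  (E : 'I_a -> set T) : Prop :=
  [/\ forall i, F (E i),
      forall i i', i != i' -> E i `&` E i' = set0 &
      \bigcup_(i in [set: 'I_a]) E i = setT].

Definition MI (dΩ : measure_display) (Ω : measurableType dΩ) (R : realType)
  (P : probability Ω R) (F G : set (set Ω)) : \bar R :=
  ereal_sup [set x | exists (a b : nat) (E : 'I_a -> set Ω) (Fp : 'I_b -> set Ω),
     [/\ is_partition Ω F a E, is_partition Ω G b Fp &
         x = (\sum_(i < a) \sum_(j < b)
                mi_term R (fine (P (E i `&` Fp j))) (fine (P (E i)))
                        (fine (P (Fp j))))%:E]].

Definition esqrt (R : realType) (x : \bar R) : \bar R :=
  match x with
  | EFin r => (Num.sqrt r)%:E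
  | EPInf => +oo%E
  | ENInf => 0%E
  end.

(* population risk L_mu(w) = E_{Z ~ mu}[loss(w, Z)] (mu lives on Zset) *)
Definition Lmu (R : realType) (m : nat) (dY : measure_display)
  (Y : measurableType dY) (Rx : R) (W : Type) (μ : probability (ZT R m dY Y) R)
  (loss : W -> ZT R m dY Y -> R) (w : W) : \bar R :=
  (\int[μ]_(z in Zset R m dY Y Rx) (loss w z)%:E)%E.

Definition LS (R : realType) (m : nat) (dY : measure_display)
  (Y : measurableType dY) (W : Type) (n : nat) (loss : W -> ZT R m dY Y -> R)
  (s : 'I_n -> ZT R m dY Y) (w : W) : R :=
  n%:R^-1 * \sum_(i < n) loss w (s i).

Definition gen (dΩ : measure_display) (Ω : measurableType dΩ) (R : realType)
  (P : probability Ω R) (m : nat) (dY : measure_display) (Y : measurableType dY)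
  (Rx : R) (Wty : Type) (μ : probability (ZT R m dY Y) R)
  (loss : Wty -> ZT R m dY Y -> R) (n : nat) (Z : 'I_n -> Ω -> ZT R m dY Y)
  (W : Ω -> Wty) : \bar R :=
  (\int[P]_ω (Lmu R m dY Y Rx Wty μ loss (W ω) - (LS R m dY Y Wty n loss (fun i => Z i ω) (W ω))%:E))%E.

(* Main.v *)
(* Chaining over the layers: with w^(k) = (W_1, ..., W_k, M_{k+1}, ..., M_d), the
   risk gap telescopes into the gap at w^(0) = M, which has mean zero, plus d
   increments whose loss is bounded by c_k = L M R beta_k and depends on
   W_1, ..., W_k only.  By Hoeffding's lemma each increment is
   (c_k / sqrt n)-subgaussian for fixed weights, so the Donsker-Varadhan
   inequality bounds its mean by (c_k / sqrt n) sqrt (2 I(S; W_1, ..., W_k)).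

   Mutual information is a supremum over finite partitions, so both variables
   are discretised: the increments are Lipschitz in the weights, hence uniformly
   approximated on finitely many cells of sigma(W_1, ..., W_k), and for the
   finitely many representative weights the bounded function of one sample is
   uniformly approximated on finitely many cells of the sample space.  Everything
   then reduces to finite sums, without product measures or joint measurability
   of the loss. *)
Require Import Defs.
From HB Require Import structures.
From mathcomp Require Import all_boot all_order all_algebra.
From mathcomp Require Import all_classical all_reals all_analysis.
From mathcomp Require Import ring lra measurable_realfun.
Import Order.TTheory GRing.Theory Num.Theory numFieldNormedType.Exports.
Local Open Scope classical_set_scope.
Local Open Scope ring_scope.

(** * Euclidean and spectral norms *)

(** Weighted Cauchy-Schwarz: the polynomial [A t^2 - 2 C t + B] is a weighted sum of squares, so it
    is non-negative for every [t]. The weights [p] are softmax probabilities in [softmax_lipschitz]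
    and equal to 1 for the Euclidean norm. *)
Lemma sum_mul_sq_le {R : realType} {I : finType} (p a b : I -> R) :
  (forall i, 0 <= p i) ->
  (\sum_i p i * a i * b i) ^+ 2 <=
    (\sum_i p i * a i ^+ 2) * (\sum_i p i * b i ^+ 2).
Proof.
move=> p0.
set A := \sum_i p i * a i ^+ 2; set B := \sum_i p i * b i ^+ 2.
set C := \sum_i p i * a i * b i.
have Q t : 0 <= A * t ^+ 2 - 2 * C * t + B.
  have -> : A * t ^+ 2 - 2 * C * t + B = \sum_i p i * (a i * t - b i) ^+ 2.
    rewrite /A /B /C mulr_suml mulr_sumr mulr_suml -sumrB -big_split /=.
    by apply: eq_bigr => i _; ring.
  by apply: sumr_ge0 => i _; rewrite mulr_ge0 ?sqr_ge0.
have A0 : 0 <= A by apply: sumr_ge0 => i _; rewrite mulr_ge0 ?sqr_ge0.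
have [A1|A1] := eqVneq A 0.
  have [->|C1] := eqVneq C 0; first by rewrite A1 expr2 !mul0r.
  (* For [A = 0] the polynomial is affine with slope [- 2 C], and this [t] would give it the value
     [-1]. *)
  have := Q ((B + 1) / (2 * C)); rewrite A1 mul0r add0r.
  have -> : - (2 * C * ((B + 1) / (2 * C))) + B = -1 by field.
  by rewrite oppr_ge0 ler10.
have A2 : 0 < A by rewrite lt_def A1 A0.
(* The minimiser of the polynomial. *)
have := Q (C / A).
have -> : A * (C / A) ^+ 2 - 2 * C * (C / A) + B = (A * B - C ^+ 2) / A by field.
by rewrite pmulr_lge0 ?invr_gt0 // subr_ge0.
Qed.

Section EuclideanNorm.
Context {R : realType}.

Lemma vnorm_ge0 k (v : 'cV[R]_k) : 0 <= vnorm R k v.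
Proof. exact: sqrtr_ge0. Qed.

Lemma sqr_vnorm k (v : 'cV[R]_k) :
  vnorm R k v ^+ 2 = \sum_(i < k) v i ord0 ^+ 2.
Proof. by rewrite sqr_sqrtr // sumr_ge0 // => i _; rewrite sqr_ge0. Qed.

Lemma vnorm0 k : vnorm R k 0 = 0.
Proof.
by rewrite /vnorm big1 ?sqrtr0 // => i _; rewrite mxE expr0n.
Qed.

Lemma vnormZ k (a : R) (v : 'cV[R]_k) : vnorm R k (a *: v) = `|a| * vnorm R k v.
Proof.
rewrite /vnorm -sqrtr_sqr -sqrtrM ?sqr_ge0// mulr_sumr; congr Num.sqrt.
by apply: eq_bigr => i _; rewrite mxE exprMn.
Qed.

Lemma vnorm_eq0 k (v : 'cV[R]_k) : vnorm R k v = 0 -> v = 0.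
Proof.
move=> v0; have := sqr_vnorm k v; rewrite v0 expr0n /= => /esym/eqP.
rewrite psumr_eq0 => [/allP h|i _]; last by rewrite sqr_ge0.
apply/colP => i; rewrite mxE; apply/eqP.
by have := h i (mem_index_enum _); rewrite sqrf_eq0.
Qed.

Lemma dotp_le_vnorm k (u v : 'cV[R]_k) :
  \sum_(i < k) u i ord0 * v i ord0 <= vnorm R k u * vnorm R k v.
Proof.
have [|/ltW h] := leP (\sum_(i < k) u i ord0 * v i ord0) 0.
  by move=> /le_trans; apply; rewrite mulr_ge0 ?vnorm_ge0.
rewrite -(@ler_pXn2r _ 2) ?nnegrE ?mulr_ge0 ?vnorm_ge0//.
rewrite exprMn !sqr_vnorm.
have := @sum_mul_sq_le R 'I_k (fun=> 1) (fun i => u i ord0) (fun i => v i ord0)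
  (fun=> ler01).
by under eq_bigr do rewrite mul1r; under [X in _ <= X * _]eq_bigr do rewrite mul1r;
  under [X in _ <= _ * X]eq_bigr do rewrite mul1r.
Qed.

Lemma vnormD k (u v : 'cV[R]_k) : vnorm R k (u + v) <= vnorm R k u + vnorm R k v.
Proof.
rewrite -(@ler_pXn2r _ 2) ?nnegrE ?addr_ge0 ?vnorm_ge0// sqrrD !sqr_vnorm.
have -> : \sum_(i < k) (u + v) i ord0 ^+ 2 =
   \sum_(i < k) u i ord0 ^+ 2 + (\sum_(i < k) u i ord0 * v i ord0) *+ 2
   + \sum_(i < k) v i ord0 ^+ 2.
  rewrite -sumrMnl -!big_split /=; apply: eq_bigr => i _.
  by rewrite mxE sqrrD.
by rewrite lerD2r lerD2l ler_pMn2r // dotp_le_vnorm.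
Qed.

Lemma vnorm_entry k (v : 'cV[R]_k) i : `|v i ord0| <= vnorm R k v.
Proof.
rewrite -(@ler_pXn2r _ 2) ?nnegrE ?vnorm_ge0// sqr_vnorm real_normK ?num_real//.
by rewrite (bigD1 i)//= lerDl sumr_ge0// => j _; rewrite sqr_ge0.
Qed.

Lemma vnorm_le_sum k (v : 'cV[R]_k) : vnorm R k v <= \sum_i `|v i ord0|.
Proof.
rewrite -(@ler_pXn2r _ 2) ?nnegrE ?vnorm_ge0 ?sumr_ge0// sqr_vnorm.
rewrite expr2 mulr_suml; apply: ler_sum => i _.
rewrite -(@real_normK _ (v i ord0)) ?num_real// expr2.
by rewrite ler_wpM2l// (bigD1 i)//= lerDl sumr_ge0.
Qed.

End EuclideanNorm.

Section SpectralNorm.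
Context {R : realType}.

(** A crude constant, which ensures that the set in [specnorm] is bounded above and that its [sup]
    is a true supremum. *)
Lemma vnorm_mulmx_le_entries p q (A : 'M[R]_(p, q)) x :
  vnorm R p (A *m x) <= (\sum_a \sum_b `|A a b|) * vnorm R q x.
Proof.
apply: le_trans (vnorm_le_sum _ _) _.
rewrite mulr_suml ler_sum// => a _; rewrite mxE mulr_suml.
apply: le_trans (ler_norm_sum _ _ _) _; apply: ler_sum => b _.
by rewrite normrM ler_wpM2l// vnorm_entry.
Qed.

Lemma specnorm_ub p q (A : 'M[R]_(p, q)) x : vnorm R q x <= 1 ->
  vnorm R p (A *m x) <= specnorm R p q A.
Proof.
move=> x1; apply: ub_le_sup; last by exists x.
exists (\sum_a \sum_b `|A a b|) => _ [y /= y1 <-].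
apply: le_trans (vnorm_mulmx_le_entries _ _ _ _) _.
by rewrite ler_piMr// sumr_ge0// => a _; rewrite sumr_ge0.
Qed.

Lemma specnorm_ge0 p q (A : 'M[R]_(p, q)) : 0 <= specnorm R p q A.
Proof. by rewrite (le_trans (vnorm_ge0 _ (A *m 0)))// specnorm_ub// vnorm0. Qed.

Lemma vnorm_mulmx p q (A : 'M[R]_(p, q)) x :
  vnorm R p (A *m x) <= specnorm R p q A * vnorm R q x.
Proof.
have [x0|x0] := eqVneq (vnorm R q x) 0.
  by rewrite (vnorm_eq0 _ _ x0) mulmx0 !vnorm0 mulr0.
have xp : 0 < vnorm R q x by rewrite lt_def x0 vnorm_ge0.
have := specnorm_ub _ _ A ((vnorm R q x)^-1 *: x).
rewrite vnormZ ger0_norm ?invr_ge0 ?vnorm_ge0// mulVf// lexx => /(_ isT).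
rewrite -scalemxAr vnormZ ger0_norm ?invr_ge0 ?vnorm_ge0//.
by rewrite mulrC ler_pdivrMr.
Qed.

Lemma specnorm_le p q (A : 'M[R]_(p, q)) c :
  (forall x, vnorm R q x <= 1 -> vnorm R p (A *m x) <= c) ->
  specnorm R p q A <= c.
Proof.
move=> h; apply: ge_sup; last by move=> _ [x /= x1 <-]; exact: h.
by exists (vnorm R p (A *m 0)), 0 => //=; rewrite vnorm0.
Qed.

Lemma specnorm0 p q : specnorm R p q 0 = 0.
Proof.
apply/le_anti; rewrite specnorm_ge0 andbT; apply: specnorm_le => x _.
by rewrite mul0mx vnorm0.
Qed.

Lemma specnormD p q (A B : 'M[R]_(p, q)) :
  specnorm R p q (A + B) <= specnorm R p q A + specnorm R p q B.
Proof.
apply: specnorm_le => x x1; rewrite mulmxDl.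
by apply: le_trans (vnormD _ _ _) _; rewrite lerD// specnorm_ub.
Qed.

Lemma specnorm_le_entries p q (A : 'M[R]_(p, q)) :
  specnorm R p q A <= \sum_a \sum_b `|A a b|.
Proof.
apply: specnorm_le => x x1; apply: le_trans (vnorm_mulmx_le_entries _ _ _ _) _.
by rewrite ler_piMr// sumr_ge0// => a _; rewrite sumr_ge0.
Qed.

Lemma entry_le_specnorm p q (A : 'M[R]_(p, q)) a b :
  `|A a b| <= specnorm R p q A.
Proof.
(* The entry is a coordinate of the image of a basis vector, which has norm 1. *)
have -> : A a b = (A *m (delta_mx b ord0 : 'cV[R]_q)) a ord0.
  rewrite mxE (bigD1 b)//= mxE !eqxx mulr1 big1 ?addr0// => j jb.
  by rewrite mxE (negbTE jb) mulr0.
apply: le_trans (vnorm_entry _ _ _) _; apply: specnorm_ub.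
rewrite /vnorm (bigD1 b)//= mxE !eqxx expr1n big1 ?addr0 ?sqrtr1// => j jb.
by rewrite mxE (negbTE jb) expr0n.
Qed.

End SpectralNorm.

(** * Softmax, Hoeffding and Donsker-Varadhan *)

Lemma is_derive_fsum {R : realType} {n : nat} (h : 'I_n -> R -> R) (dh : 'I_n -> R) (x : R) :
  (forall i, is_derive x 1 (h i) (dh i)) ->
  is_derive x 1 (fun t => \sum_(i < n) h i t) (\sum_(i < n) dh i).
Proof.
move=> hd; have -> : (fun t => \sum_(i < n) h i t) = \sum_(i < n) h i.
  by apply/funext => t; rewrite fct_sumE.
exact: is_derive_sum.
Qed.

Lemma is_derive_continuous {R : realType} (f df : R -> R) (a b : R) :
  (forall x : R, is_derive x 1 f (df x)) -> {within `[a, b], continuous f}.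
Proof.
move=> fd; apply: continuous_subspaceT => x.
by apply/differentiable_continuous/derivable1_diffP; have [] := fd x.
Qed.

(** Put [a = softmax v - softmax u] and [h = v - u]. The mean value theorem for the scalar function
    [<a, softmax (u + t h)>] on [[0, 1]] writes [|a|^2] as the covariance of [a] and [h] under a
    softmax law [p]. Cauchy-Schwarz and [p i <= 1] then give [|a|^4 <= |a|^2 |h|^2]. *)
Lemma softmax_lipschitz {R : realType} k (u v : 'cV[R]_k) :
  vnorm R k (softmax R k v - softmax R k u) <= vnorm R k (v - u).
Proof.
(* In dimension 0 the normalising sum is empty, hence not positive. *)
case: k u v => [|k] u v.
  by rewrite (_ : _ - _ = v - u)//; apply/colP => -[].
pose h i := v i ord0 - u i ord0.
pose e (i : 'I_k.+1) (t : R) := expR (u i ord0 + t * h i).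
pose a (i : 'I_k.+1) := (softmax R k.+1 v - softmax R k.+1 u) i ord0.
pose Nf t := \sum_i a i * e i t.
pose Df t := \sum_i e i t.
have D0 t : 0 < Df t.
  by rewrite /Df big_ord_recl ltr_pwDl ?expR_gt0// sumr_ge0// => i _; exact: expR_ge0.
have ed i (x : R) : is_derive x 1 (e i) (h i * e i x).
  have gd : is_derive x 1 (fun t : R => u i ord0 + t * h i) (h i).
    by apply: is_derive_eq; rewrite /GRing.scale /= !(mulr0, mulr1, mul1r, add0r, addr0).
  by rewrite mulrC; exact: (@is_derive1_comp _ expR (fun t => u i ord0 + t * h i)).
have Ndv (x : R) : is_derive x 1 Nf (\sum_i a i * (h i * e i x)).
  by apply: is_derive_fsum => i; apply: is_deriveZ.
have Ddv (x : R) : is_derive x 1 Df (\sum_i h i * e i x).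
  by apply: is_derive_fsum => i.
have gd (x : R) : is_derive x 1 (fun t => Nf t / Df t)
    ((\sum_i a i * (h i * e i x)) / Df x
     - Nf x * (\sum_i h i * e i x) / Df x ^+ 2).
  apply: is_derive_eq.
    apply: is_deriveM; apply: is_deriveV; exact: lt0r_neq0.
  by rewrite /GRing.scale /=; field; exact: lt0r_neq0.
have [c _] := @MVT_segment R _ _ 0 1 ler01 (fun x _ => gd x)
  (is_derive_continuous _ _ _ _ gd).
have e0 i : e i 0 = expR (u i ord0) by rewrite /e mul0r addr0.
have e1 i : e i 1 = expR (v i ord0) by rewrite /e mul1r addrC subrK.
have -> : Nf 1 / Df 1 - Nf 0 / Df 0 = \sum_i a i ^+ 2.
  rewrite /Nf !mulr_suml -sumrB; apply: eq_bigr => i _.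
  rewrite -!mulrA -mulrBr expr2; congr (_ * _).
  rewrite e0 e1 /a !mxE; congr (_ / _ - _ / _); apply: eq_bigr => j _;
    by rewrite ?e0 ?e1.
rewrite subr0 mulr1.
pose p i := e i c / Df c.
have p0 i : 0 <= p i by rewrite divr_ge0 ?expR_ge0 ?ltW.
have p1 : \sum_i p i = 1.
  by rewrite /p -mulr_suml; apply: divff; exact: lt0r_neq0 (D0 c).
have ple i : p i <= 1.
  by rewrite -p1 (bigD1 i)//= lerDl sumr_ge0.
have [abar abarE] : exists m, m = \sum_i p i * a i by eexists.
(* The derivative of [Nf / Df] at [c] is a covariance; centring [a] alone is enough to express
   it. *)
have -> : (\sum_i a i * (h i * e i c)) / Df c
     - Nf c * (\sum_i h i * e i c) / Df c ^+ 2 = \sum_i p i * (a i - abar) * h i.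
  have -> : \sum_i p i * (a i - abar) * h i =
     \sum_i p i * a i * h i - abar * \sum_i p i * h i.
    by rewrite mulr_sumr -sumrB; apply: eq_bigr => i _; ring.
  congr (_ - _).
    by rewrite mulr_suml; apply: eq_bigr => i _; rewrite /p; ring.
  have -> : abar = Nf c / Df c.
    by rewrite abarE /Nf mulr_suml; apply: eq_bigr => i _; rewrite /p; ring.
  have -> : \sum_i p i * h i = (\sum_i h i * e i c) / Df c.
    by rewrite mulr_suml; apply: eq_bigr => i _; rewrite /p; ring.
  by field; exact: lt0r_neq0.
move=> E.
have := @sum_mul_sq_le R _ p (fun i => a i - abar) h p0; rewrite -E.
have -> : \sum_i a i ^+ 2 = vnorm R k.+1 (softmax R k.+1 v - softmax R k.+1 u) ^+ 2.
  by rewrite sqr_vnorm.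
set x := vnorm _ _ (_ - _); set y := vnorm _ _ (_ - _).
have ple2 (f : 'I_k.+1 -> R) : \sum_i p i * f i ^+ 2 <= \sum_i f i ^+ 2.
  by apply: ler_sum => i _; rewrite ler_piMl ?sqr_ge0.
have var : \sum_i p i * (a i - abar) ^+ 2 <= x ^+ 2.
  apply: (@le_trans _ _ (\sum_i p i * a i ^+ 2)); last first.
    by rewrite /x sqr_vnorm ple2.
  have -> : \sum_i p i * (a i - abar) ^+ 2 = \sum_i p i * a i ^+ 2 - abar ^+ 2.
    have -> : \sum_i p i * (a i - abar) ^+ 2 = \sum_i p i * a i ^+ 2
       - 2 * abar * (\sum_i p i * a i) + abar ^+ 2 * \sum_i p i.
      rewrite !mulr_sumr -sumrB -big_split/=.
      by apply: eq_bigr => i _; ring.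
    by rewrite -abarE p1; ring.
  by rewrite gerBl sqr_ge0.
have varh : \sum_i p i * h i ^+ 2 <= y ^+ 2.
  rewrite /y sqr_vnorm (le_trans (ple2 _))// ler_sum// => i _.
  by rewrite !mxE.
move=> F.
have x0 : 0 <= x by exact: vnorm_ge0.
have y0 : 0 <= y by exact: vnorm_ge0.
have {F} : (x ^+ 2) ^+ 2 <= x ^+ 2 * y ^+ 2.
  apply: (le_trans F); apply: ler_pM => //; apply: sumr_ge0 => i _;
    by rewrite mulr_ge0 ?sqr_ge0.
have [->//|xn] := eqVneq x 0.
have xp : 0 < x by rewrite lt_def xn.
by rewrite expr2 ler_pM2l ?exprn_gt0// ler_pXn2r.
Qed.

Lemma out_act_lipschitz {R : realType} (so : bool) k (u v : 'cV[R]_k) :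
  vnorm R k (out_act R so k u - out_act R so k v) <= vnorm R k (u - v).
Proof. by case: so => //=; exact: softmax_lipschitz. Qed.

(** [H] is the exponent on the right minus the logarithm of the left side. It vanishes at 0 together
    with its derivative [K], and [K] has non-negative derivative because a two-point law on [{0, 1}]
    has variance at most 1/4. *)
Lemma bernoulli_mgf {R : realType} (θ s : R) : 0 <= θ <= 1 -> 0 <= s ->
  1 - θ + θ * expR s <= expR (θ * s + s ^+ 2 / 8).
Proof.
move=> /andP[θ0 θ1] s0.
pose q (t : R) : R := 1 - θ + θ * expR t.
have q0 t : 0 < q t.
  have := expR_gt0 t; rewrite /q.
  have [->|θn] := eqVneq θ 0; first by rewrite subr0 mul0r addr0.
  by move=> e0; rewrite ltr_wpDl ?subr_ge0// mulr_gt0// lt_def θn.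
pose H t := t ^+ 2 / 8 + θ * t - ln (q t).
pose K t := t / 4 + θ - θ * expR t / q t.
have qd (x : R) : is_derive x 1 q (θ * expR x).
  by apply: is_derive_eq; rewrite add0r mul1r.
have Hd (x : R) : is_derive x 1 H (K x).
  have lnd : is_derive x 1 (@ln R \o q) ((q x)^-1 * (θ * expR x)).
    by apply: is_derive1_comp; exact: is_derive1_ln.
  apply: is_derive_eq; rewrite /GRing.scale /= /K; field.
  exact: lt0r_neq0.
have Kd (x : R) : is_derive x 1 K (4^-1 - θ * expR x * (1 - θ) / q x ^+ 2).
  have qVd : is_derive x 1 (fun t => (q t)^-1) (- (q x) ^- 2 *: (θ * expR x)).
    by apply: is_deriveV => //; exact: lt0r_neq0.
  apply: is_derive_eq; rewrite /GRing.scale /= /q; field.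
  exact: lt0r_neq0 (q0 x).
have Kge t : 0 <= t -> 0 <= K t.
  move=> t0; have [c _] := @MVT_segment R K _ 0 t t0 (fun x _ => Kd x)
    (is_derive_continuous _ _ _ _ Kd).
  have -> : K 0 = 0 by rewrite /K /q expR0 mul0r add0r !mulr1 subrK divr1 subrr.
  rewrite !subr0 => ->; rewrite mulr_ge0// subr_ge0 ler_pdivrMr ?exprn_gt0//.
  rewrite /q; have := expR_gt0 c; move: (expR c) => e _.
  (* With [x = 1 - θ] and [y = θ e], this is [4 x y <= (x + y)^2], the variance bound. *)
  have := sqr_ge0 (1 - θ - θ * e); lra.
have Hge : 0 <= H s.
  have [c /andP[]] := @MVT_segment R H _ 0 s s0 (fun x _ => Hd x)
    (is_derive_continuous _ _ _ _ Hd).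
  rewrite !bnd_simp => c0 _.
  have -> : H 0 = 0.
    by rewrite /H /q expR0 mulr1 subrK ln1; field.
  by rewrite !subr0 => ->; rewrite mulr_ge0// Kge.
rewrite -/(q s) -[q s]lnK ?posrE// ler_expR.
by move: Hge; rewrite /H subr_ge0; lra.
Qed.

(** The exponential lies above its tangent at [z]; averaging the two tangent inequalities cancels
    the linear terms. *)
Lemma expR_chord {R : realType} (a x y : R) : 0 <= a <= 1 ->
  expR (a * x + (1 - a) * y) <= a * expR x + (1 - a) * expR y.
Proof.
move=> /andP[a0 a1]; set z := a * x + (1 - a) * y.
have tang w : expR z * (1 + (w - z)) <= expR w.
  by rewrite -[in leRHS](subrK z w) (expRD (w - z)) mulrC ler_wpM2r ?expR_ge0// expR_ge1Dx.
have := lerD (ler_wpM2l a0 (tang x)) (ler_wpM2l (_ : 0 <= 1 - a) (tang y)).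
rewrite subr_ge0 => /(_ a1); apply: le_trans.
by rewrite le_eqVlt; apply/orP; left; apply/eqP; rewrite /z; ring.
Qed.

(** Hoeffding's lemma for a finite law: bounding the exponential by its chord over [[-c, c]]
    replaces the law of [y] by a two-point law with the same mean, to which [bernoulli_mgf] applies
    with [s = 2 t c]. *)
Lemma hoeffding_mgf {R : realType} {I : finType} (p y : I -> R) (c t : R) :
  (forall i, 0 <= p i) -> \sum_i p i = 1 -> 0 < c -> 0 <= t ->
  (forall i, `|y i| <= c) ->
  \sum_i p i * expR (t * (\sum_j p j * y j - y i)) <=
    expR (t ^+ 2 * c ^+ 2 / 2).
Proof.
move=> p0 p1 c0 t0 yc; set m := \sum_j p j * y j.
(* The mass at [-c] of the law on [{-c, c}] with mean [m]. *)
pose θ := (c - m) / (2 * c).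
have mc : - c <= m <= c.
  rewrite -ler_norml (le_trans (ler_norm_sum _ _ _))//.
  rewrite -[leRHS]mul1r -p1 mulr_suml ler_sum// => i _.
  by rewrite normrM ger0_norm// ler_wpM2l.
have θ01 : 0 <= θ <= 1.
  by rewrite divr_ge0 ?ler_pdivrMr ?mulr_gt0//=; move/andP: mc => []; lra.
have s0 : 0 <= 2 * t * c by rewrite !mulr_ge0// ltW.
have B := bernoulli_mgf _ _ θ01 s0.
have step i : p i * expR (t * (m - y i)) <=
   p i * (expR (t * m) * ((c - y i) / (2 * c) * expR (t * c)
      + (1 - (c - y i) / (2 * c)) * expR (- (t * c)))).
  rewrite ler_wpM2l// mulrBr expRD ler_wpM2l ?expR_ge0//.
  have -> : - (t * y i) = (c - y i) / (2 * c) * (t * c)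
     + (1 - (c - y i) / (2 * c)) * - (t * c) by field; rewrite lt0r_neq0.
  apply: expR_chord; have := yc i; rewrite ler_norml => /andP[y1 y2].
  by rewrite divr_ge0 ?ler_pdivrMr ?mulr_gt0//=; lra.
apply: le_trans (ler_sum _ (fun i _ => step i)) _.
have -> : \sum_i p i * (expR (t * m) * ((c - y i) / (2 * c) * expR (t * c)
      + (1 - (c - y i) / (2 * c)) * expR (- (t * c)))) =
  expR (t * m) * (θ * expR (t * c) + (1 - θ) * expR (- (t * c))).
  under eq_bigr => i _.
    rewrite (_ : _ * _ = p i * (expR (t * m) * (expR (t * c) / 2 + expR (- (t * c)) / 2))
     + p i * y i * (expR (t * m) * (expR (- (t * c)) - expR (t * c)) / (2 * c))); last first.
      by field; rewrite lt0r_neq0.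
    over.
  rewrite big_split /= -!mulr_suml p1 -/m /θ; field; exact: lt0r_neq0.
have -> : θ * expR (t * c) + (1 - θ) * expR (- (t * c)) =
  expR (- (t * c)) * (1 - θ + θ * expR (2 * t * c)).
  have -> : 2 * t * c = t * c + t * c by ring.
  rewrite expRD expRN; field; exact: lt0r_neq0 (expR_gt0 _).
rewrite mulrA -expRD.
apply: le_trans (ler_wpM2l (expR_ge0 _) B) _.
rewrite -expRD ler_expR le_eqVlt; apply/orP; left; apply/eqP; rewrite /θ.
by field; rewrite lt0r_neq0.
Qed.

(** For [z = g - B - ln (p / (q r))], the inequality [z <= exp z - 1] multiplied by [p] bounds each
    term by [q r exp (g - B) - p], and these bounds have sum at most 0. Domination by [q] and [r]
    keeps the logarithm meaningful wherever [p > 0]. *)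
Lemma discrete_donsker_varadhan {R : realType} {I J : finType}
  (p : I -> J -> R) (q : I -> R) (r : J -> R) (g : I -> J -> R) (B : R) :
  (forall i j, 0 <= p i j) -> (forall i j, p i j <= q i) ->
  (forall i j, p i j <= r j) -> \sum_i \sum_j p i j = 1 ->
  \sum_i \sum_j q i * r j * expR (g i j) <= expR B ->
  \sum_i \sum_j p i j * g i j <=
    \sum_i \sum_j mi_term R (p i j) (q i) (r j) + B.
Proof.
move=> p0 pq pr p1 hB.
have q0 (i : I) (j : J) : 0 <= q i by rewrite (le_trans (p0 i j)).
have r0 (i : I) (j : J) : 0 <= r j by rewrite (le_trans (p0 i j)).
have term i j : p i j * g i j - mi_term R (p i j) (q i) (r j) - B * p i j <=
    q i * r j * expR (g i j) * expR (- B) - p i j.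
  rewrite /mi_term; case: eqVneq => [->|pn].
    by rewrite !(mul0r, mulr0, subr0) !mulr_ge0 ?expR_ge0 ?(q0 i j) ?(r0 i j).
  have pp : 0 < p i j by rewrite lt_def pn p0.
  have qp : 0 < q i by exact: lt_le_trans (pq i j).
  have rp : 0 < r j by exact: lt_le_trans (pr i j).
  set z := g i j - B - ln (p i j / (q i * r j)).
  have -> : p i j * g i j - p i j * ln (p i j / (q i * r j)) - B * p i j
     = p i j * z by rewrite /z; ring.
  have -> : q i * r j * expR (g i j) * expR (- B) = p i j * expR z.
    rewrite /z !expRD (expRN (ln _)) lnK ?posrE ?divr_gt0 ?mulr_gt0//.
    by field; rewrite !lt0r_neq0.
  have := ler_wpM2l (ltW pp) (expR_ge1Dx z); lra.
have {}term : \sum_i \sum_j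
    (p i j * g i j - mi_term R (p i j) (q i) (r j) - B * p i j) <=
  \sum_i \sum_j (q i * r j * expR (g i j) * expR (- B) - p i j).
  by apply: ler_sum => i _; apply: ler_sum => j _; exact: term.
have sumB (f h : I -> J -> R) : \sum_i \sum_j (f i j - h i j) =
    \sum_i \sum_j f i j - \sum_i \sum_j h i j.
  by rewrite -sumrB; apply: eq_bigr => i _; rewrite sumrB.
move: term; rewrite !sumB p1.
have -> : \sum_i \sum_j B * p i j = B.
  by under eq_bigr do rewrite -mulr_sumr; rewrite -mulr_sumr p1 mulr1.
have -> : \sum_i \sum_j q i * r j * expR (g i j) * expR (- B) =
   (\sum_i \sum_j q i * r j * expR (g i j)) * expR (- B).
  by rewrite mulr_suml; apply: eq_bigr => i _; rewrite mulr_suml.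
have : (\sum_i \sum_j q i * r j * expR (g i j)) * expR (- B) <= 1.
  by rewrite -(expRxMexpNx_1 B) ler_wpM2r ?expR_ge0.
lra.
Qed.

(** * Perturbation of the network *)

Section Network.
Context {R : realType} {d : nat} {δ : nat -> nat}.

Lemma layerE (w : Wt R d δ) k (kd : (k < d)%N) : layer R d δ w k = w (Ordinal kd).
Proof.
(* The match consumes a proof about its own boolean; once that proof is generalised the boolean can
   be replaced by [true], and two proofs of [k < d] are equal. *)
rewrite /layer; move: (erefl _); rewrite {2 3}kd => e.
by congr (w (Ordinal _)); exact: eq_irrelevance.
Qed.

Lemma layer_ord (w : Wt R d δ) (j : 'I_d) : layer R d δ w j = w j.
Proof. by case: j => j jd; rewrite layerE. Qed.

Context (M : Wt R d δ) (α : 'I_d -> R).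
Hypothesis α0 : forall j, 0 < α j.

(** Layers are counted from 0: [chain k.+1 w] and [chain k w] differ in layer [k] only, and both
    depend only on the layers [j <= k] of [w], those that generate [sigmaW] at index [k]. *)
Definition chain (k : nat) (w : Wt R d δ) : Wt R d δ :=
  fun j => if (j < k)%N then w j else M j.

Lemma chain0 w : chain 0 w = M.
Proof. exact/functional_extensionality_dep. Qed.

Lemma chain_full w : chain d w = w.
Proof. by apply: functional_extensionality_dep => j; rewrite /chain ltn_ord. Qed.

Lemma Bset_chain k w : Bset R d δ M α w -> Bset R d δ M α (chain k w).
Proof.
move=> wB j; rewrite /chain; case: ifPn => _; first exact: wB.
by rewrite subrr specnorm0 mulr_ge0 ?specnorm_ge0 ?ltW.
Qed.

Lemma layer_chain_lt k w i : (i < k)%N -> (i < d)%N ->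
  layer R d δ (chain k w) i = layer R d δ w i.
Proof. by move=> ik id; rewrite !layerE /chain/= ik. Qed.

Lemma layer_chain_ge k w i : (k <= i)%N -> (i < d)%N ->
  layer R d δ (chain k w) i = layer R d δ M i.
Proof. by move=> ik id; rewrite !layerE /chain/= ltnNge ik. Qed.

Let mn k := specnorm R _ _ (layer R d δ M k).
(** [α] extended by 0 to all naturals: the sum has at most one term. *)
Let αn k := \sum_(i < d | i == k :> nat) α i.

Let αn_ord (j : 'I_d) : αn j = α j.
Proof. by rewrite /αn (big_pred1 j). Qed.

Let αn_ge0 k : 0 <= αn k.
Proof. by apply: sumr_ge0 => i _; rewrite ltW. Qed.

Let mn_ge0 k : 0 <= mn k. Proof. exact: specnorm_ge0. Qed.

Let layer_dist w k : Bset R d δ M α w -> (k < d)%N ->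
  specnorm R _ _ (layer R d δ w k - layer R d δ M k) <= αn k * mn k.
Proof.
move=> wB kd; have := wB (Ordinal kd).
by rewrite -!layer_ord -αn_ord.
Qed.

Let layer_norm w k : Bset R d δ M α w -> (k < d)%N ->
  specnorm R _ _ (layer R d δ w k) <= (1 + αn k) * mn k.
Proof.
move=> wB kd; rewrite -(subrK (layer R d δ M k) (layer R d δ w k)).
apply: le_trans (specnormD _ _ _ _) _.
by rewrite mulrDl mul1r addrC lerD2l layer_dist.
Qed.

Context (φ : forall k : nat, 'cV[R]_k -> 'cV[R]_k) (so : bool) (Rx : R).
Hypothesis φ_lip : forall k, (0 < k < d)%N -> forall u v : 'cV[R]_(δ k),
  vnorm R _ (φ _ u - φ _ v) <= vnorm R _ (u - v).
Hypothesis φ0 : forall k, (0 < k < d)%N -> φ (δ k) 0 = 0.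
Hypothesis Rx0 : 0 <= Rx.
Hypothesis d0 : (0 < d)%N.

Let hid w x k := hidden R d δ φ w x k.
Let pre w x k := layer R d δ w k *m hid w x k.

Let hidS_dist w w' x k : (k.+1 < d)%N ->
  vnorm R _ (hid w x k.+1 - hid w' x k.+1) <= vnorm R _ (pre w x k - pre w' x k).
Proof. by move=> kd; apply: φ_lip. Qed.

Let hid_norm w x k : Bset R d δ M α w -> vnorm R _ x <= Rx -> (k < d)%N ->
  vnorm R _ (hid w x k) <= (\prod_(i < k) ((1 + αn i) * mn i)) * Rx.
Proof.
move=> wB xR; elim: k => [|k IH] kd; first by rewrite big_ord0 mul1r.
(* Subtracting [φ 0 = 0] turns the Lipschitz bound into a bound on the norm. *)
rewrite big_ord_recr /= -[hid _ _ _]subr0 -(φ0 k.+1)// mulrAC mulrC.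
apply: le_trans (φ_lip _ _ _ _) _ => //; rewrite subr0.
apply: le_trans (vnorm_mulmx _ _ _ _) _.
by rewrite ler_pM ?specnorm_ge0 ?vnorm_ge0 ?layer_norm ?IH// ltnW.
Qed.

(** Splits the error into the one inherited from the layers below and the one created by the current
    matrix. *)
Let pre_dist w w' x k :
  vnorm R _ (pre w x k - pre w' x k) <=
  specnorm R _ _ (layer R d δ w k) * vnorm R _ (hid w x k - hid w' x k) +
  specnorm R _ _ (layer R d δ w k - layer R d δ w' k) * vnorm R _ (hid w' x k).
Proof.
have -> : pre w x k - pre w' x k =
  layer R d δ w k *m (hid w x k - hid w' x k) +
  (layer R d δ w k - layer R d δ w' k) *m hid w' x k.
  by rewrite mulmxBr mulmxBl addrA subrK.
by apply: le_trans (vnormD _ _ _) _; rewrite lerD// vnorm_mulmx.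
Qed.

Let net_dist w w' x : vnorm R _ (net R d δ φ so w x - net R d δ φ so w' x) <=
  vnorm R _ (pre w x d.-1 - pre w' x d.-1).
Proof. exact: out_act_lipschitz. Qed.

Let hid_eq w w' x k : (k <= d)%N ->
  (forall i, (i < k)%N -> layer R d δ w i = layer R d δ w' i) ->
  hid w x k = hid w' x k.
Proof.
elim: k => [//|k IH] kd e; rewrite /hid /= e// -!/(hid _ _ _) IH//; first exact: ltnW.
by move=> i ik; rewrite e// ltnW.
Qed.

(** Below layer [k] the two networks agree, so layer [k] creates an error through [W - M] alone.
    Above it both use the matrices of [M], and each further layer multiplies the error by at most
    [mn]. The induction is on the number [n] of layers above [k]. *)
Let pre_chain w x k : Bset R d δ M α w -> vnorm R _ x <= Rx -> (k < d)%N ->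
  forall n, (k + n < d)%N ->
  vnorm R _ (pre (chain k.+1 w) x (k + n) - pre (chain k w) x (k + n)) <=
  αn k * (\prod_(i < k) (1 + αn i)) * (\prod_(i < (k + n).+1) mn i) * Rx.
Proof.
move=> wB xR kd; elim => [|n IH] knd.
  rewrite addn0; apply: le_trans (pre_dist _ _ _ _) _.
  have -> : hid (chain k.+1 w) x k = hid (chain k w) x k.
    apply: hid_eq; first exact: ltnW.
    move=> i ik; have id_ : (i < d)%N := ltn_trans ik kd.
    by rewrite !layer_chain_lt// ltnS ltnW.
  rewrite subrr vnorm0 mulr0 add0r layer_chain_lt// layer_chain_ge//.
  apply: le_trans (ler_pM _ _ (layer_dist _ _ wB kd)
    (hid_norm _ _ _ (Bset_chain k _ wB) xR kd)) _;
    rewrite ?specnorm_ge0 ?vnorm_ge0//.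
  rewrite big_split /= big_ord_recr /= le_eqVlt; apply/orP; left; apply/eqP.
  by ring.
rewrite addnS in knd *; apply: le_trans (pre_dist _ _ _ _) _.
rewrite !layer_chain_ge ?ltnS ?leq_addr// 1?ltnW// ?ltnS ?leq_addr//.
rewrite subrr specnorm0 mul0r addr0 big_ord_recr /= -/(mn _).
rewrite [leRHS](_ : _ = mn (k + n).+1 * (αn k * \prod_(i < k) (1 + αn i) *
  (\prod_(i < (k + n).+1) mn i) * Rx)); last by ring.
rewrite ler_wpM2l//; apply: le_trans (hidS_dist _ _ _ _ knd) _.
by apply: IH; exact: ltnW.
Qed.

Lemma net_chain_dist (k : 'I_d) w x : Bset R d δ M α w -> vnorm R _ x <= Rx ->
  vnorm R _ (net R d δ φ so (chain k.+1 w) x - net R d δ φ so (chain k w) x) <=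
  α k * expR (\sum_(i < d | (i < k)%N) α i) *
  (\prod_(j < d) specnorm R _ _ (M j)) * Rx.
Proof.
move=> wB xR; apply: le_trans (net_dist _ _ _) _.
have e : (k + (d.-1 - k) = d.-1)%N by rewrite subnKC// -ltnS prednK.
have := pre_chain w x k wB xR (ltn_ord k) (d.-1 - k).
have dd : (d.-1 < d)%N by rewrite prednK.
rewrite e => /(_ dd) /le_trans; apply; rewrite αn_ord.
have -> : \prod_(i < d.-1.+1) mn i = \prod_(j < d) specnorm R _ _ (M j).
  rewrite prednK//; by apply: eq_bigr => j _; rewrite /mn layer_ord.
rewrite ler_wpM2r// ler_wpM2r ?prodr_ge0// => [j _|]; first exact: specnorm_ge0.
rewrite ler_wpM2l ?(ltW (α0 k))//.
have -> : \sum_(i < d | (i < k)%N) α i = \sum_(i < k) αn i.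
  rewrite (big_ord_narrow (ltnW (ltn_ord k))); apply: eq_bigr => i _.
  by rewrite -αn_ord.
(* The factors [1 + α i] are at most [expR (α i)], which produces the exponential in [β]. *)
rewrite expR_sum ler_prod// => i _.
by rewrite addr_ge0//= expR_ge1Dx.
Qed.

(** Lipschitz dependence on the weights, uniform over [Bset] and over the input ball. Only the
    existence of [C] matters, as it serves the discretisation and not the final constant. *)
Let pre_cont k : (k < d)%N -> exists2 C, 0 <= C & forall w w' x η,
  Bset R d δ M α w -> Bset R d δ M α w' -> vnorm R _ x <= Rx -> 0 <= η ->
  (forall j : 'I_d, specnorm R _ _ (w j - w' j) <= η) ->
  vnorm R _ (pre w x k - pre w' x k) <= C * η.
Proof.
elim: k => [|k IH] kd.
  exists Rx => // w w' x η wB wB' xR η0 h; apply: le_trans (pre_dist _ _ _ _) _.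
  rewrite /hid /= subrr vnorm0 mulr0 add0r mulrC !(layerE _ _ kd).
  by apply: ler_pM; rewrite ?specnorm_ge0 ?vnorm_ge0//; exact: (h (Ordinal kd)).
have [C C0 hC] := IH (ltnW kd).
exists ((1 + αn k.+1) * mn k.+1 * C + \prod_(i < k.+1) ((1 + αn i) * mn i) * Rx).
  rewrite addr_ge0// ?mulr_ge0 ?addr_ge0// prodr_ge0// => i _.
  by rewrite mulr_ge0 ?addr_ge0.
move=> w w' x η wB wB' xR η0 h; apply: le_trans (pre_dist _ _ _ _) _.
rewrite mulrDl lerD//.
  rewrite -[leRHS]mulrA; apply: ler_pM;
    rewrite ?specnorm_ge0 ?vnorm_ge0 ?layer_norm//.
  by apply: le_trans (hidS_dist _ _ _ _ kd) _; exact: hC.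
rewrite mulrC; apply: ler_pM; rewrite ?specnorm_ge0 ?vnorm_ge0//.
  exact: hid_norm.
by rewrite !(layerE _ _ kd); exact: (h (Ordinal kd)).
Qed.

Lemma net_unif_cont (ε : R) : 0 < ε -> exists2 η, 0 < η & forall w w',
  Bset R d δ M α w -> Bset R d δ M α w' ->
  (forall j a b, `|w j a b - w' j a b| <= η) ->
  forall x, vnorm R _ x <= Rx ->
  vnorm R _ (net R d δ φ so w x - net R d δ φ so w' x) <= ε.
Proof.
move=> ε0; have [|C C0 hC] := pre_cont d.-1; first by rewrite prednK.
(* [N] exceeds the number of entries of any layer, which converts entrywise closeness into spectral
   closeness; the added 1 here and in [C + 1] makes the denominator positive. *)
pose N : R := 1 + \sum_(j < d) (δ j.+1 * δ j)%:R.
have N0 : 0 < N by rewrite ltr_pwDl// sumr_ge0.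
have D0 : 0 < (C + 1) * N by rewrite mulr_gt0// ltr_wpDl.
exists (ε / ((C + 1) * N)) => [|w w' wB wB' h x xR]; first by rewrite divr_gt0.
apply: le_trans (net_dist _ _ _) _.
apply: le_trans (hC w w' x (ε / (C + 1)) wB wB' xR _ _) _.
- by rewrite divr_ge0 ?addr_ge0// ltW.
- move=> j; apply: le_trans (specnorm_le_entries _ _ _) _.
  apply: (@le_trans _ _ (N * (ε / ((C + 1) * N)))); last first.
    rewrite le_eqVlt; apply/orP; left; apply/eqP; field.
    by rewrite !lt0r_neq0// ltr_wpDl.
  apply: (@le_trans _ _ ((δ j.+1 * δ j)%:R * (ε / ((C + 1) * N)))).
    have -> : (δ j.+1 * δ j)%:R * (ε / ((C + 1) * N)) =
      \sum_(a < δ j.+1) \sum_(b < δ j) (ε / ((C + 1) * N)).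
      by rewrite !sumr_const !card_ord -mulrnA mulnC mulr_natl.
    by apply: ler_sum => a _; apply: ler_sum => b _; rewrite !mxE.
  rewrite ler_wpM2r// ?divr_ge0 ?(ltW ε0) ?(ltW D0)// /N (bigD1 j)//=.
  by rewrite addrA -[leLHS]add0r -addrA lerD// lerDl sumr_ge0.
- rewrite mulrA ler_pdivrMr ?ltr_wpDl// mulrC ler_wpM2l ?(ltW ε0)//.
  by rewrite lerDl.
Qed.

End Network.

(** * Finite discretisations and mutual information *)

Lemma preimage_pair_set1 {T A B : Type} (f : T -> A) (g : T -> B) a b :
  (fun x => (f x, g x)) @^-1` [set (a, b)] = f @^-1` [set a] `&` g @^-1` [set b].
Proof. by apply/seteqP; split => x /= => [[-> ->]|[-> ->]]. Qed.

(** Each function takes values in [[-K, K]], which is cut into bins of length [ε]; the code lists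
    the bins, one function at a time. [F] stands for the measurable sets of the sample space in one
    use and for a sigma-algebra generated by weights in the other. *)
Lemma finite_discretisation {R : realType} {T : Type} {J : finType}
  (F : set (set T)) (f : J -> T -> R) (K ε : R) :
  F setT -> setI_closed F -> 0 < ε ->
  (forall j B, measurable B -> F (f j @^-1` B)) ->
  (forall j x, `|f j x| <= K) ->
  exists (C : finType) (c : T -> C), (forall a, F (c @^-1` [set a])) /\
    forall x y, c x = c y -> forall j, `|f j x - f j y| <= ε.
Proof.
move=> FT FI ε0 Ff fK.
suff [C [c [cF ce]]] : exists (C : finType) (c : T -> C),
    (forall a, F (c @^-1` [set a])) /\
    forall x y, c x = c y -> forall j, j \in enum J -> `|f j x - f j y| <= ε.
  by exists C, c; split => // x y /ce h j; apply: h; rewrite mem_enum.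
elim: (enum J) => [|j s [C [c [cF ce]]]].
  exists unit, (fun=> tt); split => // -[].
  by rewrite (_ : _ @^-1` _ = setT)//; apply/seteqP; split.
have K0 x : 0 <= (f j x + K) / ε.
  by rewrite divr_ge0 ?(ltW ε0)// -lerBlDr sub0r; have := fK j x; rewrite ler_norml => /andP[].
(* The last bin: [(f j x + K) / ε] ranges in [[0, 2 K / ε]]. *)
pose N := Num.trunc (2 * K / ε).
pose g x : 'I_N.+1 := inord (Num.trunc ((f j x + K) / ε)).
have gN x : (Num.trunc ((f j x + K) / ε) < N.+1)%N.
  rewrite ltnS le_truncn// ler_pM2r ?invr_gt0// mulr_natl mulr2n lerD2r.
  by have := fK j x; rewrite ler_norml => /andP[].
have gE x (b : 'I_N.+1) : g x = b <-> b%:R <= (f j x + K) / ε < b.+1%:R.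
  split => [<-|h]; first by rewrite inordK// trunc_itv.
  by apply: val_inj; rewrite /= inordK//; exact: trunc_def.
exists (C * 'I_N.+1)%type, (fun x => (c x, g x)); split.
  move=> [a b]; rewrite preimage_pair_set1; apply: FI => //.
  have -> : g @^-1` [set b] = f j @^-1` `[b%:R * ε - K, b.+1%:R * ε - K[%classic.
    apply/seteqP; split => x /=.
      by move/gE; rewrite in_itv/= ler_pdivlMr// ltr_pdivrMr// lerBlDr ltrBrDr.
    rewrite in_itv/= lerBlDr ltrBrDr => h.
    by apply/gE; rewrite ler_pdivlMr// ltr_pdivrMr.
  by apply: Ff; exact: measurable_itv.
move=> x y [cxy gxy] i; rewrite in_cons => /predU1P[->|]; last exact: ce.
have := (gE x (g x)).1 erefl; have := (gE y (g x)).1 (esym gxy).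
rewrite !ler_pdivlMr// !ltr_pdivrMr// -natr1 mulrDl mul1r.
by rewrite ler_norml => /andP[? ?] /andP[? ?]; apply/andP; split; lra.
Qed.

Section FiniteCode.
Context {R : realType} {d : measure_display} {T : measurableType d}
  (P : probability T R).

Lemma probability_inhabited : inhabited T.
Proof.
apply: contrapT => h; have := @probability_setT _ _ _ P.
have -> : [set: T] = set0 by apply/seteqP; split => // x; case: h; exists.
by rewrite measure0 => /esym/eqP; rewrite onee_eq0.
Qed.

(** Picks a representative in every non-empty cell; codes that are not attained get an arbitrary
    point, available because a probability space is non-empty. *)
Lemma code_section {A : Type} (c : T -> A) :
  exists s : A -> T, forall x, c (s (c x)) = c x.
Proof.
have [t0] := probability_inhabited.
have : forall a, exists t, forall x, c x = a -> c t = a.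
  move=> a; have [[x xa]|h] := pselect (exists x, c x = a); first by exists x.
  by exists t0 => x xa; case: h; exists x.
by move=> /choice[s hs]; exists s => x; exact: hs.
Qed.

Lemma bounded_integrable (f : T -> R) K : measurable_fun setT f ->
  (forall x, `|f x| <= K) -> P.-integrable setT (EFin \o f).
Proof.
move=> mf fK; apply: measurable_bounded_integrable => //.
  by rewrite (le_lt_trans (probability_le1 P _))// ltry.
exists K; split; first exact: num_real.
by move=> x Kx z _; rewrite /= (le_trans (fK z))// ltW.
Qed.

Context {C : finType} (c : T -> C).
Hypothesis mc : forall a, measurable (c @^-1` [set a]).

Lemma code_integral (h : C -> R) :
  P.-integrable setT (fun x => (h (c x))%:E) /\
  (\int[P]_x (h (c x))%:E = (\sum_a h a * fine (P (c @^-1` [set a])))%:E)%E.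
Proof.
have E : (fun x => (h (c x))%:E) =
    (fun x => \sum_a ((h a)%:E * (\1_(c @^-1` [set a]) x)%:E))%E.
  apply/funext => x; rewrite (bigD1 (c x))//= big1 ?adde0; last first.
    move=> a ax; rewrite indicE memNset ?mule0//= => cxa.
    by rewrite cxa eqxx in ax.
  by rewrite indicE mem_set ?mule1.
have I a : P.-integrable setT (fun x => ((h a)%:E * (\1_(c @^-1` [set a]) x)%:E)%E).
  by apply: integrableZl => //; exact: integrable_indic.
rewrite E; split; first exact: integrable_sum.
rewrite integral_sum// -sumEFin; apply: eq_bigr => a _.
rewrite integralZl//; last exact: integrable_indic.
by rewrite integral_indic// setIT EFinM fineK// fin_num_measure.
Qed.

Lemma code_sum1 : \sum_a fine (P (c @^-1` [set a])) = 1.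
Proof.
have [_] := code_integral (fun=> 1).
rewrite integral_cst// mul1e => e; case: (etrans (esym (probability_setT P)) e).
by under eq_bigr do rewrite mul1r.
Qed.

Lemma code_ge0 a : 0 <= fine (P (c @^-1` [set a])).
Proof. exact/fine_ge0/measure_ge0. Qed.

End FiniteCode.

Lemma MI_ge_code {d} {Ω : measurableType d} {R : realType} (P : probability Ω R)
  (F G : set (set Ω)) {A B : finType} (f : Ω -> A) (g : Ω -> B) :
  (forall a, F (f @^-1` [set a])) -> (forall b, G (g @^-1` [set b])) ->
  ((\sum_a \sum_b mi_term R (fine (P (f @^-1` [set a] `&` g @^-1` [set b])))
     (fine (P (f @^-1` [set a]))) (fine (P (g @^-1` [set b]))))%:E
   <= MI d Ω R P F G)%E.
Proof.
move=> fF gG; apply: ereal_sup_ubound.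
exists #|A|, #|B|, (fun i => f @^-1` [set enum_val i]),
  (fun i => g @^-1` [set enum_val i]).
have part (C : finType) (h : Ω -> C) (H : set (set Ω)) :
    (forall a, H (h @^-1` [set a])) ->
    is_partition Ω H #|C| (fun i => h @^-1` [set enum_val i]).
  move=> hH; split => //.
    move=> i i' ii'; apply/seteqP; split => // x /= [-> /enum_val_inj e].
    by rewrite e eqxx in ii'.
  apply/seteqP; split => // x _; exists (enum_rank (h x)) => //=.
  by rewrite enum_rankK.
split; [exact: part|exact: part|congr EFin].
have sumE (C : finType) (h : C -> R) : \sum_a h a = \sum_(i < #|C|) h (enum_val i).
  by rewrite (reindex (fun i : 'I_#|C| => enum_val i))//; exact/onW_bij/enum_val_bij.
by rewrite sumE; apply: eq_bigr => i _; rewrite sumE.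
Qed.

Lemma le_sqrt_of_quadratic {R : realType} (A r σ : R) : 0 < σ ->
  (forall t, 0 <= t -> t * A <= r + t ^+ 2 * σ ^+ 2 / 2) ->
  A <= σ * Num.sqrt 2 * Num.sqrt r.
Proof.
move=> σ0 h; have [A0|A0] := leP A 0.
  by rewrite (le_trans A0)// !mulr_ge0 ?sqrtr_ge0// ltW.
(* This [t] maximises [t A - t^2 σ^2 / 2], with value [A^2 / (2 σ^2)]. Since [A > 0], the hypothesis
   there also forces [r >= 0], so that [Num.sqrt r] squares to [r]. *)
have t0 : 0 <= A / σ ^+ 2 by rewrite divr_ge0 ?sqr_ge0// ltW.
have := h _ t0.
have -> : A / σ ^+ 2 * A = A ^+ 2 / σ ^+ 2 by field; exact: lt0r_neq0.
have -> : (A / σ ^+ 2) ^+ 2 * σ ^+ 2 / 2 = A ^+ 2 / σ ^+ 2 / 2.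
  by field; exact: lt0r_neq0.
set q := A ^+ 2 / σ ^+ 2 => qr.
have q2 : q <= 2 * r by lra.
have q0 : 0 < q by rewrite divr_gt0 ?exprn_gt0.
have r0 : 0 <= r by lra.
rewrite -(@ler_pXn2r _ 2) ?nnegrE ?mulr_ge0 ?sqrtr_ge0 ?(ltW A0) ?(ltW σ0)//.
rewrite !exprMn !sqr_sqrtr// -mulrA.
by move: q2; rewrite /q ler_pdivrMr ?exprn_gt0// mulrC.
Qed.

(** * One increment of the chain *)

(** For fixed [b] the exponential factorises over the [n] independent samples. Hoeffding's lemma at
    [t / n] bounds each factor, and [n (t / n)^2 c^2 = t^2 (c / sqrt n)^2]. *)
Lemma mgf_empirical_mean {R : realType} {A B : finType} {n : nat}
  (u : A -> R) (v : B -> R) (y : B -> A -> R) (c t : R) :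
  (0 < n)%N -> (forall a, 0 <= u a) -> \sum_a u a = 1 ->
  (forall b, 0 <= v b) -> \sum_b v b = 1 -> 0 < c -> 0 <= t ->
  (forall b a, `|y b a| <= c) ->
  \sum_(s : {ffun 'I_n -> A}) \sum_b (\prod_i u (s i)) * v b *
     expR (t * (\sum_a u a * y b a - n%:R^-1 * \sum_i y b (s i)))
  <= expR (t ^+ 2 * (c / Num.sqrt n%:R) ^+ 2 / 2).
Proof.
move=> n0 u0 u1 v0 v1 c0 t0 yc.
have nR0 : (n%:R : R) != 0 by rewrite pnatr_eq0 -lt0n.
rewrite exchange_big /=.
rewrite -[leRHS]mul1r -[X in _ <= X * _]v1 mulr_suml; apply: ler_sum => b _.
set m := \sum_a u a * y b a.
have -> : \sum_(s : {ffun 'I_n -> A}) (\prod_i u (s i)) * v b *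
     expR (t * (m - n%:R^-1 * \sum_i y b (s i))) =
   v b * \sum_(s : {ffun 'I_n -> A}) \prod_i
     (u (s i) * expR (t / n%:R * (m - y b (s i)))).
  rewrite mulr_sumr; apply: eq_bigr => s _.
  rewrite big_split /= -expR_sum -mulr_sumr sumrB sumr_const card_ord.
  rewrite mulrA (mulrC (v b)); congr (_ * expR _).
  by rewrite -mulr_natr; field.
rewrite ler_wpM2l//.
(* A sum over all samples of a product is the product of the sums. *)
rewrite -(bigA_distr_bigA (fun (_ : 'I_n) a => u a * expR (t / n%:R * (m - y b a)))).
rewrite prodr_const card_ord.
have tn0 : 0 <= t / n%:R by rewrite divr_ge0.
have H := hoeffding_mgf u (y b) c (t / n%:R) u0 u1 c0 tn0 (yc b).
have -> : expR (t ^+ 2 * (c / Num.sqrt n%:R) ^+ 2 / 2) =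
   expR ((t / n%:R) ^+ 2 * c ^+ 2 / 2) ^+ n.
  rewrite -expRM_natl exprMn exprVn sqr_sqrtr//; congr expR; by field.
by rewrite lerXn2r ?nnegrE ?expR_ge0// sumr_ge0// => a _; rewrite mulr_ge0 ?expR_ge0.
Qed.

Section ChainStep.
Context {R : realType} {dΩ dT : measure_display}
  {Ω : measurableType dΩ} {T : measurableType dT}
  (P : probability Ω R) (μ : probability T R)
  {n : nat} (Z : 'I_n -> Ω -> T) (F G : set (set Ω)).
Hypothesis n0 : (0 < n)%N.
Hypothesis iid : forall A : 'I_n -> set T, (forall i, measurable (A i)) ->
  P (\bigcap_(i in [set: 'I_n]) (Z i @^-1` A i)) = (\prod_(i < n) μ (A i))%E.
Hypothesis F_meas : F `<=` measurable.
Hypothesis G_meas : G `<=` measurable.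
Hypothesis F_cyl : forall A : 'I_n -> set T, (forall i, measurable (A i)) ->
  F (\bigcap_(i in [set: 'I_n]) (Z i @^-1` A i)).
Context {V : Type} (U : Ω -> V) (ψ : V -> T -> R) (c : R).
Hypothesis c0 : 0 < c.
Hypothesis mψ : forall ω, measurable_fun setT (ψ (U ω)).
Hypothesis ψc : forall ω z, `|ψ (U ω) z| <= c.

(** The gap is dominated by a function [g] of the finite codes of sample and weights, whose integral
    is a finite sum. The discretisation errors cost [2 ε] in the population mean and [2 ε] in the
    empirical mean. *)
Lemma chain_step (r ε : R) {C : finType} (k : Ω -> C) :
  (MI dΩ Ω R P F G <= r%:E)%E -> 0 < ε ->
  (forall b, G (k @^-1` [set b])) ->
  (forall ω ω', k ω = k ω' -> forall z, `|ψ (U ω) z - ψ (U ω') z| <= ε) ->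
  exists g : Ω -> R, [/\ P.-integrable setT (EFin \o g),
    (forall ω, fine (\int[μ]_z (ψ (U ω) z)%:E)%E
       - n%:R^-1 * \sum_i ψ (U ω) (Z i ω) <= g ω) &
    (\int[P]_ω (g ω)%:E <=
       (c / Num.sqrt n%:R * Num.sqrt 2 * Num.sqrt r + 4 * ε)%:E)%E].
Proof.
move=> MIr ε0 kG kψ.
have nR0 : (n%:R : R) != 0 by rewrite pnatr_eq0 -lt0n.
have [rep krep] := code_section P k.
(* Only the finitely many functions attached to the representatives [rep b] have to be approximated
   on the sample space. *)
have [A [e [me eψ]]] : exists (A : finType) (e : T -> A),
    (forall a, measurable (e @^-1` [set a])) /\
    forall x y, e x = e y -> forall b, `|ψ (U (rep b)) x - ψ (U (rep b)) y| <= ε.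
  apply: (finite_discretisation measurable (fun b => ψ (U (rep b))) c ε) => //.
  - exact: measurableI.
  - by move=> b B mB; rewrite -[X in measurable X]setTI; exact: mψ.
have [rz erz] := code_section μ e.
pose y b a := ψ (U (rep b)) (rz a).
pose u a := fine (μ (e @^-1` [set a])).
pose S ω : {ffun 'I_n -> A} := [ffun i => e (Z i ω)].
(* Cells of the sample code are cylinders: they belong to [F], and by independence their
   probabilities are products. *)
have Spre s : S @^-1` [set s] =
    \bigcap_(i in [set: 'I_n]) (Z i @^-1` (e @^-1` [set (s i)])).
  apply/seteqP; split => ω /=; first by move=> <- i _ /=; rewrite ffunE.
  by move=> h; apply/ffunP => i; rewrite ffunE; exact: h.
have SF s : F (S @^-1` [set s]) by rewrite Spre; exact: F_cyl.
have mS s : measurable (S @^-1` [set s]) by exact: F_meas.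
have mk b : measurable (k @^-1` [set b]) by exact: G_meas.
pose q s := fine (P (S @^-1` [set s])).
pose v b := fine (P (k @^-1` [set b])).
pose p s b := fine (P (S @^-1` [set s] `&` k @^-1` [set b])).
have qE s : q s = \prod_i u (s i).
  rewrite /q Spre iid// /u.
  have -> : (\prod_(i < n) μ (e @^-1` [set s i]) =
      (\prod_(i < n) fine (μ (e @^-1` [set s i])))%:E)%E.
    rewrite -prodEFin; apply: eq_bigr => i _.
    by rewrite fineK// fin_num_measure.
  by [].
have u0 a : 0 <= u a by exact: code_ge0.
have u1 : \sum_a u a = 1 by exact: code_sum1.
have v0 b : 0 <= v b by exact: code_ge0.
have v1 : \sum_b v b = 1 by exact: code_sum1.
have p0 s b : 0 <= p s b by exact/fine_ge0/measure_ge0.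
have mSk s b : measurable (S @^-1` [set s] `&` k @^-1` [set b]) by exact: measurableI.
have pq s b : p s b <= q s.
  by rewrite fine_le ?fin_num_measure// le_measure ?inE//; exact: subIsetl.
have pv s b : p s b <= v b.
  by rewrite fine_le ?fin_num_measure// le_measure ?inE//; exact: subIsetr.
pose Sk ω := (S ω, k ω).
have mSk' sb : measurable (Sk @^-1` [set sb]).
  by case: sb => s b; rewrite preimage_pair_set1.
have pE sb : fine (P (Sk @^-1` [set sb])) = p sb.1 sb.2.
  by case: sb => s b; rewrite preimage_pair_set1.
have p1 : \sum_s \sum_b p s b = 1.
  rewrite pair_big /= -(code_sum1 P Sk mSk').
  by apply: eq_bigr => sb _; rewrite pE.
pose m b := \sum_a u a * y b a.
pose g0 (s : {ffun 'I_n -> A}) b := m b - n%:R^-1 * \sum_i y b (s i).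
pose h (sb : {ffun 'I_n -> A} * C) := g0 sb.1 sb.2 + 4 * ε.
have [hI hE] := code_integral P Sk mSk' h.
exists (fun ω => h (Sk ω)); split => //.
- move=> ω; set b := k ω.
  have near_rep z : `|ψ (U ω) z - ψ (U (rep b)) z| <= ε.
    by apply: kψ; rewrite krep.
  (* One [ε] for moving the weights to their representative, one for moving [z] to the
     representative of its cell. *)
  have near_y z : `|ψ (U ω) z - y b (e z)| <= 2 * ε.
    rewrite -[ψ _ _](subrK (ψ (U (rep b)) z)) -addrA.
    rewrite (le_trans (ler_normD _ _))// mulr_natl mulr2n lerD//.
    by apply: eψ; rewrite erz.
  have mean : fine (\int[μ]_z (ψ (U ω) z)%:E)%E <= m b + 2 * ε.
    have [yI yE] := code_integral μ e me (fun a => y b a + 2 * ε).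
    have ψI := bounded_integrable μ (ψ (U ω)) c (mψ ω) (ψc ω).
    rewrite -lee_fin fineK; last exact: integrable_fin_num.
    have -> : m b + 2 * ε = \sum_a (y b a + 2 * ε) * u a.
      rewrite -[2 * ε in LHS]mulr1 -u1 mulr_sumr -big_split /=.
      by apply: eq_bigr => a _; ring.
    rewrite -yE; apply: le_integral => // z _; rewrite lee_fin.
    by have := near_y z; rewrite ler_norml => /andP[_]; lra.
  have emp : n%:R^-1 * \sum_i y b (S ω i) - 2 * ε <=
      n%:R^-1 * \sum_i ψ (U ω) (Z i ω).
    have -> : n%:R^-1 * \sum_i y b (S ω i) - 2 * ε =
        n%:R^-1 * \sum_(i < n) (y b (S ω i) - 2 * ε).
      by rewrite sumrB sumr_const card_ord -mulr_natr; field.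
    rewrite ler_wpM2l ?invr_ge0// ler_sum// => i _; rewrite ffunE.
    by have := near_y (Z i ω); rewrite ler_norml => /andP[]; lra.
  by rewrite /h /g0 /= -/b; lra.
rewrite hE lee_fin.
have -> : \sum_a h a * fine (P (Sk @^-1` [set a])) =
    \sum_s \sum_b p s b * g0 s b + 4 * ε.
  under eq_bigr do rewrite pE /h mulrDl.
  rewrite big_split /= -mulr_sumr; congr (_ + _).
    by rewrite pair_big /=; apply: eq_bigr => -[s b] _; rewrite mulrC.
  by rewrite -(pair_big xpredT xpredT p) p1 mulr1.
rewrite lerD2r; apply: le_sqrt_of_quadratic.
  by rewrite divr_gt0// sqrtr_gt0 ltr0n.
move=> t t0.
have -> : t * (\sum_s \sum_b p s b * g0 s b) = \sum_s \sum_b p s b * (t * g0 s b).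
  rewrite mulr_sumr; apply: eq_bigr => s _; rewrite mulr_sumr.
  by apply: eq_bigr => b _; ring.
apply: le_trans (discrete_donsker_varadhan p q v (fun s b => t * g0 s b)
  (t ^+ 2 * (c / Num.sqrt n%:R) ^+ 2 / 2) p0 pq pv p1 _) _.
  (* Under the product of the marginals the sample is independent of the weight code, which is the
     setting of [mgf_empirical_mean]. *)
  under eq_bigr do under eq_bigr do rewrite qE.
  exact: (mgf_empirical_mean u v y c t n0 u0 u1 v0 v1 c0 t0 (fun b a => ψc _ _)).
rewrite lerD2r -lee_fin; apply: le_trans MIr.
exact: (MI_ge_code P F G S k SF kG).
Qed.

End ChainStep.

(** The integral of a non-negative function is a supremum over the simple functions below it, hence
    monotone for arbitrary functions; positive and negative parts give the signed case. It compares
    the integrand of [gen] with the dominating sum. *)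
Lemma le_integral_nonmeasurable {R : realType} {d} {T : measurableType d}
  (μ : {measure set T -> \bar R}) (f g : T -> \bar R) :
  (forall x, (f x <= g x)%E) -> (\int[μ]_x f x <= \int[μ]_x g x)%E.
Proof.
have ge0_le (u v : T -> \bar R) : (forall x, 0 <= u x)%E ->
    (forall x, u x <= v x)%E -> (\int[μ]_x u x <= \int[μ]_x v x)%E.
  move=> u0 uv; rewrite !ge0_integralTE//; last by move=> x; exact: le_trans (uv x).
  apply: ereal_sup_le => _ [h hu <-].
  by exists h => //= x; exact: le_trans (hu x) (uv x).
move=> fg; rewrite (integralE _ _ f) (integralE _ _ g); apply: leeB.
  apply: ge0_le => x; first exact: funepos_ge0.
  by apply: (@funepos_le _ _ setT f g); rewrite ?inE.
apply: ge0_le => x; first exact: funeneg_ge0.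
by apply: (@funeneg_le _ _ setT f g); rewrite ?inE.
Qed.

(** * Sigma-algebras of the sample and of the weights *)

Lemma integral_same_law {R : realType} {dΩ dT} {Ω : measurableType dΩ}
  {T : measurableType dT} (P : {measure set Ω -> \bar R})
  (μ : {measure set T -> \bar R}) (X : Ω -> T) (f : T -> R) :
  measurable_fun setT X -> (forall A, measurable A -> P (X @^-1` A) = μ A) ->
  μ.-integrable setT (EFin \o f) ->
  P.-integrable setT (fun ω => (f (X ω))%:E) /\
  (\int[P]_ω (f (X ω))%:E = \int[μ]_z (f z)%:E)%E.
Proof.
move=> mX law fI.
have /measurable_int mf := fI.
have /measurable_EFinP mfr := mf.
have fXI : P.-integrable setT (fun ω => (f (X ω))%:E).
  apply/integrableP; split.
    by apply/measurable_EFinP; exact: (measurableT_comp mfr mX).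
  move/integrableP : fI => [_]; apply: le_lt_trans.
  rewrite -(@eq_measure_integral _ _ _ setT μ (pushforward P X))//; last first.
    by move=> A mA _; exact: law.
  rewrite (ge0_integral_pushforward mX)//.
  by apply: measurableT_comp.
split => //.
rewrite -(@eq_measure_integral _ _ _ setT μ (pushforward P X))//; last first.
  by move=> A mA _; exact: law.
by rewrite (integral_pushforward mX).
Qed.

(** Take the whole space for every coordinate other than [i]. *)
Lemma iid_marginal {R : realType} {dΩ dT} {Ω : measurableType dΩ}
  {T : measurableType dT} (P : probability Ω R) (μ : probability T R)
  {n : nat} (Z : 'I_n -> Ω -> T) :
  (forall A : 'I_n -> set T, (forall i, measurable (A i)) ->
    P (\bigcap_(i in [set: 'I_n]) (Z i @^-1` A i)) = (\prod_(i < n) μ (A i))%E) ->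
  forall i A, measurable A -> P (Z i @^-1` A) = μ A.
Proof.
move=> iid i A mA; have := iid (fun j => if j == i then A else setT).
rewrite (bigD1 i)//= eqxx big1 ?mule1; last first.
  by move=> j /negbTE ->; exact: probability_setT.
move=> <-; last by move=> j; case: ifP.
congr (P _); apply/seteqP; split => ω /=; last by move=> /(_ i Logic.I); rewrite /= eqxx.
by move=> ZA j _ /=; case: eqP => [->|].
Qed.

Section GeneratedSigmaAlgebras.
Context {R : realType} {dΩ : measure_display} {Ω : measurableType dΩ}.

Lemma measurable_Zset m {dY} {Y : measurableType dY} (Rx : R) : 0 <= Rx ->
  measurable (Zset R m dY Y Rx).
Proof.
move=> Rx0.
have -> : Zset R m dY Y Rx =
    (fun z : ZT R m dY Y => \sum_(i < m) (z.1 : 'cV[R]_m) i ord0 ^+ 2) @^-1`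
      `]-oo, Rx ^+ 2]%classic.
  apply/seteqP; split => z; rewrite /Zset /= in_itv /= -sqr_vnorm;
    by rewrite ler_pXn2r ?nnegrE ?vnorm_ge0.
rewrite -[X in measurable X]setTI.
have mcoord i : measurable_fun [set: XT R m] (fun x : XT R m => (x : 'cV[R]_m) i ord0).
  move=> _ B mB; rewrite setTI; apply: sub_sigma_algebra.
  by exists i, B.
have mS : measurable_fun setT (fun z : ZT R m dY Y =>
    \sum_(i < m) (z.1 : 'cV[R]_m) i ord0 ^+ 2).
  apply: measurable_sum => i; apply: measurable_funX.
  exact: (measurableT_comp (mcoord i) measurable_fst).
by apply: mS => //; exact: measurable_itv.
Qed.

Lemma sigmaS_measurable {m dY} {Y : measurableType dY} {n}
  (Z : 'I_n -> Ω -> ZT R m dY Y) : (forall i, measurable_fun setT (Z i)) ->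
  sigmaS dΩ Ω R m dY Y n Z `<=` measurable.
Proof.
move=> mZ; apply: smallest_sub; first exact: sigma_algebra_measurable.
by move=> _ [i [A [mA ->]]]; rewrite -[X in measurable X]setTI; exact: mZ.
Qed.

Lemma sigmaS_cylinder {m dY} {Y : measurableType dY} {n}
  (Z : 'I_n -> Ω -> ZT R m dY Y) (A : 'I_n -> set (ZT R m dY Y)) :
  (forall i, measurable (A i)) ->
  sigmaS dΩ Ω R m dY Y n Z (\bigcap_(i in [set: 'I_n]) (Z i @^-1` A i)).
Proof.
move=> mA; rewrite /sigmaS; set G := (X in <<s X >>).
apply: (@fin_bigcap_measurable _ (g_sigma_algebraType G)) => // i _.
by apply: sub_sigma_algebra; exists i, (A i).
Qed.

Lemma sigmaW_measurable {d δ} (W : Ω -> WT R d δ) k : measurable_fun setT W ->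
  sigmaW dΩ Ω R d δ W k `<=` measurable.
Proof.
move=> mW; apply: smallest_sub; first exact: sigma_algebra_measurable.
move=> _ [j [a [b [B [_ [mB ->]]]]]]; rewrite -[X in measurable X]setTI.
apply: (mW measurableT [set w : Wt R d δ | B (w j a b)]).
by apply: sub_sigma_algebra; exists j, a, b, B.
Qed.

Lemma sigmaW_discretisation {d δ} (W : Ω -> WT R d δ) (k : nat) (K η : R) :
  0 <= K -> 0 < η -> (forall ω j a b, `|W ω j a b| <= K) ->
  exists (C : finType) (c : Ω -> C),
    (forall x, sigmaW dΩ Ω R d δ W k (c @^-1` [set x])) /\
    forall ω ω', c ω = c ω' -> forall j : 'I_d, (j <= k)%N ->
      forall a b, `|W ω j a b - W ω' j a b| <= η.
Proof.
move=> K0 η0 WK.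
pose J : finType := {j : 'I_d & 'I_(δ j.+1) * 'I_(δ j)}%type.
(* Setting the entries of layers beyond [k] to 0 lets one finite index type serve every [k], while
   the cells stay in the sigma-algebra of the layers up to [k]. *)
pose f (t : J) ω := if (tag t <= k)%N then
  W ω (tag t) (tagged t).1 (tagged t).2 else 0.
rewrite /sigmaW; set G := (X in <<s X >>).
have [C [c [cF ce]]] : exists (C : finType) (c : Ω -> C),
    (forall x, <<s G >> (c @^-1` [set x])) /\
    forall x y, c x = c y -> forall t, `|f t x - f t y| <= η.
  apply: (finite_discretisation <<s G >> f K η) => // [||t B mB|t ω].
  - exact: (@measurableT _ (g_sigma_algebraType G)).
  - exact: (@measurableI _ (g_sigma_algebraType G)).
  - rewrite /f; case jk: (tag t <= k)%N.
      apply: sub_sigma_algebra.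
      by exists (tag t), (tagged t).1, (tagged t).2, B.
    rewrite preimage_cst; case: ifP => _.
      exact: (@measurableT _ (g_sigma_algebraType G)).
    exact: (@measurable0 _ (g_sigma_algebraType G)).
  - by rewrite /f; case: ifP => // _; rewrite normr0.
exists C, c; split => // ω ω' cc j jk a b.
have := ce _ _ cc (Tagged (fun j : 'I_d => ('I_(δ j.+1) * 'I_(δ j))%type) (a, b)).
by rewrite /f /= jk.
Qed.

End GeneratedSigmaAlgebras.

(** * Bounded weights, extended square roots and assembly of the layers *)

Lemma Bset_bounded {R : realType} {d δ} (M : Wt R d δ) (α : 'I_d -> R) :
  (forall j, 0 < α j) -> exists2 K, 0 <= K & forall w, Bset R d δ M α w ->
  forall j a b, `|w j a b| <= K.
Proof.
move=> α0; pose F j := (α j + 1) * specnorm R _ _ (M j).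
have F0 j : 0 <= F j by rewrite mulr_ge0 ?specnorm_ge0// addr_ge0// ltW.
exists (\sum_j F j) => [|w wB j a b]; first exact: sumr_ge0.
apply: le_trans (entry_le_specnorm _ _ _ _ _) _.
rewrite (bigD1 j)//= -[leLHS]addr0 lerD ?sumr_ge0// /F mulrDl mul1r.
rewrite -[w j](subrK (M j)); apply: le_trans (specnormD _ _ _ _) _.
by rewrite lerD2r; exact: wB.
Qed.

(** At [-oo] both sides are 0, since [fine] has default value 0 there. *)
Lemma esqrt_fine {R : realType} (x : \bar R) : x != +oo%E ->
  esqrt R x = (Num.sqrt (fine x))%:E.
Proof. by case: x => //= _; rewrite sqrtr0. Qed.

Lemma esqrt_ge0 {R : realType} (x : \bar R) : (0 <= esqrt R x)%E.
Proof. by case: x => //= r; rewrite lee_fin sqrtr_ge0. Qed.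

Theorem theorem1
  (R : realType) (d : nat) (δ : nat -> nat) (Rx : R)
  (M : Wt R d δ) (α : 'I_d -> R)
  (φ : forall k : nat, 'cV[R]_k -> 'cV[R]_k) (so : bool)
  (dY : measure_display) (Y : measurableType dY)
  (loss : WT R d δ -> ZT R (δ 0%N) dY Y -> R) (L : R)
  (n : nat) (μ : probability (ZT R (δ 0%N) dY Y) R)
  (dΩ : measure_display) (Ω : measurableType dΩ) (P : probability Ω R)
  (Z : 'I_n -> Ω -> ZT R (δ 0%N) dY Y) (W : Ω -> WT R d δ) :
  (* architecture *)
  (2 <= d)%N ->
  (forall k, (k <= d)%N -> (0 < δ k)%N) ->
  0 < Rx ->
  (forall j : 'I_d, 0 < specnorm R _ _ (M j)) ->
  (forall j : 'I_d, 0 < α j) ->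
  (* phi is 1-Lipschitz and phi(0) = 0 in every hidden dimension *)
  (forall k, (0 < k < d)%N -> forall u v : 'cV[R]_(δ k),
      vnorm R _ (φ _ u - φ _ v) <= vnorm R _ (u - v)) ->
  (forall k, (0 < k < d)%N -> φ (δ k) 0 = 0) ->
  (* the loss *)
  measurable_fun ((Bset R d δ M α : set (WT R d δ)) `*` Zset R (δ 0%N) dY Y Rx)
    (fun p : WT R d δ * ZT R (δ 0%N) dY Y => loss p.1 p.2) ->
  (forall w z, Bset R d δ M α w -> Zset R (δ 0%N) dY Y Rx z -> 0 <= loss w z) ->
  0 < L ->
  (forall w w' z, Bset R d δ M α w -> Bset R d δ M α w' ->
     Zset R (δ 0%N) dY Y Rx z ->
     `|loss w z - loss w' z| <=
       L * vnorm R _ (net R d δ φ so w z.1 - net R d δ φ so w' z.1)) ->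
  (forall w, Bset R d δ M α w ->
     μ.-integrable (Zset R (δ 0%N) dY Y Rx) (fun z => (loss w z)%:E)) ->
  (* mu is a distribution on Z *)
  μ (Zset R (δ 0%N) dY Y Rx) = 1%E ->
  (* S = (Z_1, ..., Z_n) i.i.d. ~ mu, W any random element of B_1 x ... x B_d *)
  (0 < n)%N ->
  (forall i, measurable_fun setT (Z i)) ->
  measurable_fun setT W ->
  (forall A : 'I_n -> set (ZT R (δ 0%N) dY Y), (forall i, measurable (A i)) ->
     P (\bigcap_(i in [set: 'I_n]) (Z i @^-1` A i)) = (\prod_(i < n) μ (A i))%E) ->
  (forall ω i, Zset R (δ 0%N) dY Y Rx (Z i ω)) ->
  (forall ω, Bset R d δ M α (W ω)) ->
  (gen dΩ Ω R P (δ 0%N) dY Y Rx (WT R d δ) μ loss n Z W <=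
   (L * (\prod_(j < d) specnorm R _ _ (M j)) * Rx * Num.sqrt 2
      / Num.sqrt n%:R)%:E *
   \sum_(k < d)
     ((α k * expR (\sum_(i < d | (i < k)%N) α i))%:E *
      esqrt R (MI dΩ Ω R P (sigmaS dΩ Ω R (δ 0%N) dY Y n Z) (sigmaW dΩ Ω R d δ W k))))%E.
Proof.
move=> d2 δ0 Rx0 M0 α0 φlip φ0 mloss loss0 L0 lossL lossI μZ n0 mZ mW iid ZD WB.
have d0 : (0 < d)%N by exact: ltnW.
have nR0 : (n%:R : R) != 0 by rewrite pnatr_eq0 -lt0n.
set D := Zset R (δ 0%N) dY Y Rx.
set FS := sigmaS dΩ Ω R (δ 0%N) dY Y n Z.
pose MIk (k : 'I_d) := MI dΩ Ω R P FS (sigmaW dΩ Ω R d δ W k).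
pose β (k : 'I_d) := α k * expR (\sum_(i < d | (i < k)%N) α i).
set Π := \prod_(j < d) specnorm R _ _ (M j).
have Π0 : 0 < Π by apply: prodr_gt0 => j _; exact: M0.
have β0 k : 0 < β k by rewrite mulr_gt0 ?expR_gt0.
set C := L * Π * Rx * Num.sqrt 2 / Num.sqrt n%:R.
have C0 : 0 < C by rewrite divr_gt0 ?mulr_gt0 ?sqrtr_gt0 ?ltr0n.
(* If some mutual information is infinite, the right side is [+oo]: [C] and all [β k] are positive,
   and the other terms are non-negative. *)
have [[k0 hk]|fin] := pselect (exists k, MIk k = +oo%E).
  rewrite (bigD1 k0)//= -/(MIk k0) hk -/(β k0) gt0_muley ?lte_fin//.
  rewrite addye; last first.
    rewrite gt_eqF// (lt_le_trans (ltNyr 0))// sume_ge0// => k _.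
    by rewrite mule_ge0 ?esqrt_ge0// lee_fin; exact: ltW (β0 k).
  by rewrite gt0_muley ?lte_fin// leey.
pose r k := fine (MIk k).
have rE k : esqrt R (MIk k) = (Num.sqrt (r k))%:E.
  by apply: esqrt_fine; apply/eqP => h; apply: fin; exists k.
have MIr k : (MIk k <= (r k)%:E)%E.
  rewrite /r; case E : (MIk k) => [x| |]//=; last by rewrite leNye.
  by case: fin; exists k.
have -> : (\sum_(k < d) ((α k * expR (\sum_(i < d | (i < k)%N) α i))%:E *
      esqrt R (MI dΩ Ω R P FS (sigmaW dΩ Ω R d δ W k))) =
    (\sum_(k < d) β k * Num.sqrt (r k))%:E)%E.
  by rewrite -sumEFin; apply: eq_bigr => k _; rewrite -/(MIk k) rE EFinM.
rewrite -EFinM.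
(* The loss extended by 0 outside [D]: integrals then run over the whole space, and the increments
   are bounded everywhere. *)
pose lD (w : Wt R d δ) (z : ZT R (δ 0%N) dY Y) : R :=
  if z \in D then loss w z else 0.
have mD : measurable D by apply: measurable_Zset; exact: ltW.
have lD_patch w : (fun z => (loss w z)%:E) \_ D = EFin \o lD w.
  by apply/funext => z; rewrite patchE /lD /=; case: ifP.
have lDI w : Bset R d δ M α w -> μ.-integrable setT (EFin \o lD w).
  by move=> wB; rewrite -lD_patch; apply/(integrable_mkcond _ mD); exact: lossI.
pose lmu w := fine (\int[μ]_z (lD w z)%:E)%E.
have LmuE w : Bset R d δ M α w ->
    Lmu R (δ 0%N) dY Y Rx (WT R d δ) μ loss w = (lmu w)%:E.
  move=> wB; rewrite /Lmu integral_mkcond lD_patch /lmu fineK//.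
  by apply: integrable_fin_num => //; exact: lDI.
have chainB k ω : Bset R d δ M α (chain M k (W ω)) by exact: Bset_chain.
have MB : Bset R d δ M α M.
  by have [ω0] := probability_inhabited P; have := chainB 0%N ω0; rewrite chain0.
have lD_dist w w' z e : Bset R d δ M α w -> Bset R d δ M α w' -> 0 <= e ->
    (forall x, vnorm R _ x <= Rx ->
      vnorm R _ (net R d δ φ so w x - net R d δ φ so w' x) <= e) ->
    `|lD w z - lD w' z| <= L * e.
  move=> wB wB' e0 h; rewrite /lD; case: ifPn => zD; last first.
    by rewrite subrr normr0 mulr_ge0// ltW.
  rewrite inE in zD; apply: le_trans (lossL _ _ _ wB wB' zD) _.
  by rewrite ler_pM2l// h.
pose c k := L * (β k * Π * Rx).
have βΠ0 k : 0 < β k * Π * Rx := mulr_gt0 (mulr_gt0 (β0 k) Π0) Rx0.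
have c0 k : 0 < c k := mulr_gt0 L0 (βΠ0 k).
pose ψ (k : nat) (w : Wt R d δ) z := lD (chain M k.+1 w) z - lD (chain M k w) z.
(* The risk gap at [chain M k (W ω)]: [T d] is the integrand of [gen], while [T 0] involves only the
   fixed weights [M]. *)
pose T (k : nat) ω := lmu (chain M k (W ω)) -
  n%:R^-1 * \sum_i lD (chain M k (W ω)) (Z i ω).
have TE k ω : fine (\int[μ]_z (ψ k (W ω) z)%:E)%E
    - n%:R^-1 * \sum_i ψ k (W ω) (Z i ω) = T k.+1 ω - T k ω.
  rewrite /ψ /T /lmu integralB_EFin//; [|exact: lDI..].
  rewrite fineB ?integrable_fin_num//; [|exact: lDI..].
  by rewrite sumrB mulrBr; ring.
apply/lee_addgt0Pr => ε ε0.
(* Each of the [d] increments loses [4 ε'] in [chain_step]. *)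
pose ε' := ε / (4 * d%:R).
have dR0 : (0 : R) < d%:R by rewrite ltr0n.
have ε'0 : 0 < ε' by rewrite divr_gt0// mulr_gt0.
have [K K0 hK] := Bset_bounded M α α0.
have /choice[g hg] : forall k : 'I_d, exists g : Ω -> R,
    [/\ P.-integrable setT (EFin \o g),
      (forall ω, T k.+1 ω - T k ω <= g ω) &
      (\int[P]_ω (g ω)%:E <= (c k / Num.sqrt n%:R * Num.sqrt 2 *
        Num.sqrt (r k) + 4 * ε')%:E)%E].
  move=> k.
  (* An increment involves two networks, each moving the loss by at most [L e']. *)
  pose e' := ε' / (2 * L).
  have e'0 : 0 < e' by rewrite divr_gt0// mulr_gt0.
  have [η η0 hη] := net_unif_cont M α α0 φ so Rx φlip φ0 (ltW Rx0) d0 e' e'0.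
  have [A [a [aG ha]]] := sigmaW_discretisation W k K η K0 η0
    (fun ω => hK _ (WB ω)).
  have mψ ω : measurable_fun setT (ψ k (W ω)).
    apply: measurable_funB;
      by apply/measurable_EFinP; apply: measurable_int (lDI _ _).
  have ψc ω z : `|ψ k (W ω) z| <= c k.
    apply: lD_dist => //.
      exact: ltW (βΠ0 k).
    by move=> x xR; apply: net_chain_dist => //; exact: ltW.
  have aψ ω ω' : a ω = a ω' -> forall z, `|ψ k (W ω) z - ψ k (W ω') z| <= ε'.
    move=> /ha close z.
    have chain_close j : (j <= k.+1)%N ->
        `|lD (chain M j (W ω)) z - lD (chain M j (W ω')) z| <= L * e'.
      move=> jk; apply: lD_dist => //; first exact: ltW.
      (* Layers [i < j] satisfy [i <= k] and are close by the code; the others are those of [M] on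
         both sides. *)
      apply: hη => // i p q; rewrite /chain; case: ifPn => ij.
        by apply: close; rewrite -ltnS (leq_trans ij).
      by rewrite subrr normr0 ltW.
    have -> : ε' = L * e' + L * e' by rewrite /e'; field; rewrite lt0r_neq0.
    have -> : ψ k (W ω) z - ψ k (W ω') z =
        (lD (chain M k.+1 (W ω)) z - lD (chain M k.+1 (W ω')) z)
        - (lD (chain M k (W ω)) z - lD (chain M k (W ω')) z).
      by rewrite /ψ; ring.
    by apply: le_trans (ler_normB _ _) _; rewrite lerD ?chain_close.
  have [g [gI gT gE]] := chain_step P μ Z FS (sigmaW dΩ Ω R d δ W k) n0 iid
    (sigmaS_measurable Z mZ) (sigmaW_measurable W k mW) (sigmaS_cylinder Z)
    W (ψ k) (c k) (c0 k) mψ ψc (r k) ε' a (MIr k) ε'0 aG aψ.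
  by exists g; split => // ω; rewrite -TE.
(* The contribution of one sample to [T 0]; it has mean zero under [μ], hence at every [Z i]. *)
pose u z := n%:R^-1 * (lmu M - lD M z).
have uI : μ.-integrable setT (EFin \o u).
  have -> : EFin \o u = (fun z => (n%:R^-1)%:E * ((lmu M)%:E - (lD M z)%:E))%E.
    by apply/funext => z; rewrite /u /= EFinM EFinB.
  apply: integrableZl => //; apply: integrableB => //; last exact: lDI.
  exact: finite_measure_integrable_cst.
have u0 : (\int[μ]_z (u z)%:E = 0)%E.
  have -> : (fun z => (u z)%:E) =
      (fun z => (n%:R^-1)%:E * ((lmu M)%:E - (lD M z)%:E))%E.
    by apply/funext => z; rewrite /u /= EFinM EFinB.
  rewrite integralZl//; last first.
    apply: integrableB => //; last exact: lDI.
    exact: finite_measure_integrable_cst.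
  rewrite integralB_EFin//; [|exact: finite_measure_integrable_cst|exact: lDI].
  have -> : (\int[μ]_z (lmu M)%:E = (lmu M)%:E)%E.
    rewrite integral_cst// -[RHS]mule1; congr (_ * _)%E; exact: probability_setT.
  rewrite /lmu fineK ?subee ?mule0//;
    by apply: integrable_fin_num => //; exact: lDI.
have uZ i := integral_same_law P μ (Z i) u (mZ i) (iid_marginal P μ Z iid i) uI.
apply: (@le_trans _ _ (\int[P]_ω
    (\sum_i (u (Z i ω))%:E + \sum_(k < d) (g k ω)%:E))%E).
  apply: le_integral_nonmeasurable => ω; rewrite LmuE// -EFinB !sumEFin -EFinD lee_fin.
  have -> : lmu (W ω) - LS R (δ 0%N) dY Y (WT R d δ) n loss (Z^~ ω) (W ω) = T d ω.
    rewrite /T chain_full /LS; congr (_ - _ * _); apply: eq_bigr => i _.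
    by rewrite /lD ifT//; apply: mem_set; exact: ZD.
  have -> : \sum_i u (Z i ω) = T 0%N ω.
    rewrite /T chain0 /u -mulr_sumr sumrB sumr_const card_ord mulrBr.
    by rewrite -[lmu M *+ n]mulr_natl mulrA mulVf// mul1r.
  rewrite -lerBlDl -(telescope_sumr (T^~ ω))// big_mkord.
  by apply: ler_sum => k _; have [_ + _] := hg k.
rewrite integralD//; [|by apply: integrable_sum => // i _; have [] := uZ i
  |by apply: integrable_sum => // k _; have [] := hg k].
rewrite !integral_sum//; [|by move=> k; have [] := hg k|by move=> i; have [] := uZ i].
rewrite big1 ?add0e; last by move=> i _; have [_ ->] := uZ i.
apply: (@le_trans _ _ (\sum_(k < d) (c k / Num.sqrt n%:R * Num.sqrt 2 *
        Num.sqrt (r k) + 4 * ε')%:E)%E).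
  by apply: lee_sum => k _; have [] := hg k.
rewrite sumEFin -EFinD lee_fin big_split /= sumr_const card_ord.
have -> : (4 * ε') *+ d = ε.
  by rewrite -mulr_natl /ε'; field; rewrite lt0r_neq0.
rewrite lerD2r mulr_sumr ler_sum// => k _.
by rewrite le_eqVlt; apply/orP; left; apply/eqP; rewrite /c /C; ring.
Qed.
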